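(* Let $(A,\mathfrak{m})$ be a Noetherian local ring of dimension $d>0$ with infinite residue field $A/\mathfrak{m}$, and let $\mathfrak{F}=(I_n)_{n\ge0}$ be a good filtration of $A$ with $I_{n+1}\subseteq \mathfrak{m}I_n$ for all $n\ge 0$. Suppose $s(\mathfrak{F})=1$. Then $$\operatorname{reg} F(\mathfrak{F})\le \operatorname{reg} G(\mathfrak{F}).$$ Furthermore, if $\operatorname{grade} I_1=1$, then $\operatorname{reg} F(\mathfrak{F})=\operatorname{reg} G(\mathfrak{F})=r(\mathfrak{F})$.
   Context: Rings are commutative. A filtration of $A$ is a sequence $\mathfrak{F}=(I_n)_{n\ge0}$ of ideals with $I_0=A\supset I_1\supseteq I_2\supseteq\cdots$, $I_1\ne A$ and $I_iI_j\subseteq I_{i+j}$ for all $i,j\ge 0$. It is a good filtration if there is an ideal $I$ of $A$ with $I I_i\subseteq I_{i+1}$ for all $i\ge 0$ and $I_{n+1}=I I_n$ for all $n\gg 0$. $R(\mathfrak{F})=\bigoplus_{n\ge 0} I_nt^n$ is the Rees algebra, $G(\mathfrak{F})=\bigoplus_{n\ge0} I_n/I_{n+1}$ the associated graded ring, $F(\mathfrak{F})=R(\mathfrak{F})/\mathfrak{m}R(\mathfrak{F})=\bigoplus_{n\ge0} I_n/\mathfrak{m}I_n$ the fiber cone, and $s(\mathfrak{F})=\dim F(\mathfrak{F})$ the analytic spread. A reduction of $\mathfrak{F}$ is an ideal $J\subseteq I_1$ with $JI_n=I_{n+1}$ for $n\gg0$; a minimal reduction is a reduction minimal under containment. For a minimal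 reduction $J$, $r_J(\mathfrak{F})=\sup\{n\in\mathbb{Z}: I_n\ne JI_{n-1}\}$ (with $I_n=A$ for $n\le 0$), and the reduction number is $r(\mathfrak{F})=\min\{r_J(\mathfrak{F}): J \text{ a minimal reduction of } \mathfrak{F}\}$. For a nonnegatively graded ring $S$, $S_+$ is the ideal generated by homogeneous elements of positive degree; for a graded $S$-module $M$, $a_i(M)=\max\{n:[H^i_{S_+}(M)]_n\ne0\}$ (and $-\infty$ if $H^i_{S_+}(M)=0$), and $\operatorname{reg} M=\max\{a_i(M)+i: i\ge0\}$. $\operatorname{reg} F(\mathfrak{F})$ and $\operatorname{reg} G(\mathfrak{F})$ are taken with $S=M$ equal to the respective ring. *)

(* Defs.v *)
From HB Require Import structures.
From mathcomp Require Import all_boot all_order all_algebra.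
From mathcomp Require Import all_classical constructive_ereal ring.

Set Implicit Arguments.
Unset Strict Implicit.
Unset Printing Implicit Defensive.

Import Order.TTheory GRing.Theory Num.Theory.
Local Open Scope ring_scope.
Local Open Scope classical_set_scope.
Local Open Scope quotient_scope.

(* Suprema and infima live in \bar int, so that sup set0 = -oo and
   inf set0 = +oo. *)
Definition esup (E : set int) : \bar int :=
  supremum -oo%E [set n%:E | n in E].

Definition einf (E : set (\bar int)) : \bar int := infimum +oo%E E.

Section Ideals.
Variable R : comNzRingType.
Implicit Types (I J X : set R) (s : seq R).

Definition is_ideal I :=
  [/\ I 0, forall x y, I x -> I y -> I (x + y)
    & forall a x, I x -> I (a * x)].

Definition ideal_gen X : set R := smallest is_ideal X.

Definition ideal_prod I J : set R :=
  ideal_gen [set x * y | x in I & y in J].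

Definition noetherian :=
  forall I, is_ideal I -> exists s, I = ideal_gen [set` s].

Definition is_maximal I :=
  [/\ is_ideal I, I <> setT
    & forall J, is_ideal J -> I `<=` J -> J = I \/ J = setT].

Definition is_prime (P : set R) :=
  [/\ is_ideal P, P <> setT & forall x y, P (x * y) -> P x \/ P y].

Definition prime_chain (n : nat) (P : nat -> set R) :=
  (forall i, (i <= n)%N -> is_prime (P i)) /\
  (forall i, (i < n)%N -> P i `<` P i.+1).

Definition krull_dim : \bar int :=
  esup [set n%:Z | n in [set n : nat | exists P, prime_chain n P]].

Definition regular_seq s :=
  ideal_gen [set` s] <> setT /\
  forall i, (i < size s)%N -> forall x,
    ideal_gen [set` take i s] (s`_i * x) -> ideal_gen [set` take i s] x.

Definition grade I : \bar int :=
  esup [set (size s)%:Z | s in [set s : seq R | [set` s] `<=` I /\ regular_seq s]].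

Lemma ideal_gen_ideal X : is_ideal (ideal_gen X).
Proof.
split=> [I [[]]//|x y Ix Iy I II|a x Ix I II].
- by case: II.1 => _ + _; apply; [exact: Ix|exact: Iy].
- by case: II.1 => _ _; apply; exact: Ix.
Qed.

Lemma ideal_prodM I J x y : I x -> J y -> ideal_prod I J (x * y).
Proof. by move=> Ix Jy K [_]; apply; exists x => //; exists y. Qed.

End Ideals.

Arguments noetherian R : clear implicits.
Arguments krull_dim R : clear implicits.

Definition local_ring (A : comNzRingType) (m : idealr A) :=
  forall I : set A, is_maximal I <-> I = [set` m].

Section Localization.
Variables (R : comNzRingType) (f : R).

(* The pair (s, k) stands for the fraction s / f ^+ k. *)
Definition loc_pre : Type := (R * nat)%type.
HB.instance Definition _ := Choice.on loc_pre.

Definition loc_equiv (u v : loc_pre) : bool :=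
  `[< exists l, f ^+ l * (f ^+ v.2 * u.1) = f ^+ l * (f ^+ u.2 * v.1) >].

Lemma loc_equiv_is_equiv : equiv_class_of loc_equiv.
Proof.
have sym u v : loc_equiv u v -> loc_equiv v u.
  by move=> /asboolP[l e]; apply/asboolP; exists l.
split=> [u|u v|v u w].
- by apply/asboolP; exists 0%N.
- by apply/idP/idP; exact: sym.
- move=> /asboolP[k e] /asboolP[l e']; apply/asboolP.
  exists (k + l + v.2)%N; rewrite !exprD.
  move: e e'; set a := f ^+ k; set b := f ^+ l => e e'.
  transitivity (b * f ^+ w.2 * (a * (f ^+ v.2 * u.1))); first by ring.
  rewrite e; transitivity (a * f ^+ u.2 * (b * (f ^+ w.2 * v.1))); first by ring.
  by rewrite e'; ring.
Qed.

Canonical loc_equiv_equiv := EquivRelPack loc_equiv_is_equiv.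
Canonical loc_equiv_encModRel := defaultEncModRel loc_equiv.

Definition loc := {eq_quot loc_equiv}.
HB.instance Definition _ : EqQuotient loc_pre loc_equiv loc := EqQuotient.on loc.
HB.instance Definition _ := Choice.on loc.

Definition loc_frac (s : R) (k : nat) : loc := \pi_loc ((s, k) : loc_pre).

Lemma loc_fracP s k s' k' :
  (exists l, f ^+ l * (f ^+ k' * s) = f ^+ l * (f ^+ k * s')) <->
  loc_frac s k = loc_frac s' k'.
Proof.
split=> [h|/eqP]; first by apply/eqP; rewrite piE /=; apply/asboolP.
by rewrite piE => /asboolP.
Qed.

Lemma loc_frac_repr (x : loc) :
  x = loc_frac (repr x : loc_pre).1 (repr x : loc_pre).2.
Proof. by rewrite /loc_frac -surjective_pairing reprK. Qed.

Definition loc_zero : loc := loc_frac 0 0.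

Definition loc_opp (x : loc) : loc :=
  let u : loc_pre := repr x in loc_frac (- u.1) u.2.

Definition loc_add (x y : loc) : loc :=
  let u : loc_pre := repr x in let v : loc_pre := repr y in
  loc_frac (f ^+ v.2 * u.1 + f ^+ u.2 * v.1) (u.2 + v.2).

Lemma loc_oppE s k : loc_opp (loc_frac s k) = loc_frac (- s) k.
Proof.
have /loc_fracP[l e] := loc_frac_repr (loc_frac s k).
by apply/loc_fracP; exists l; rewrite !mulrN e.
Qed.

Lemma loc_addE s k s' k' :
  loc_add (loc_frac s k) (loc_frac s' k') =
  loc_frac (f ^+ k' * s + f ^+ k * s') (k + k').
Proof.
rewrite /loc_add.
have := loc_frac_repr (loc_frac s' k').
have := loc_frac_repr (loc_frac s k).
move: (repr (loc_frac s k)) (repr (loc_frac s' k')) => -[t j] [t' j'] /=.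
move=> /loc_fracP[l e] /loc_fracP[l' e'].
apply/loc_fracP; exists (l + l')%N; rewrite !exprD.
move: e e'; set a := f ^+ l; set b := f ^+ l' => e e'.
transitivity (a * (f ^+ k * t) * (b * f ^+ k' * f ^+ j') +
              b * (f ^+ k' * t') * (a * f ^+ k * f ^+ j)); first by ring.
by rewrite -e -e'; ring.
Qed.

Lemma loc_addA : associative loc_add.
Proof.
move=> x y z.
rewrite (loc_frac_repr x) (loc_frac_repr y) (loc_frac_repr z) !loc_addE.
by apply/loc_fracP; exists 0%N; rewrite !exprD; ring.
Qed.

Lemma loc_addC : commutative loc_add.
Proof.
move=> x y; rewrite (loc_frac_repr x) (loc_frac_repr y) !loc_addE.
by apply/loc_fracP; exists 0%N; rewrite !exprD; ring.
Qed.

Lemma loc_add0 : left_id loc_zero loc_add.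
Proof.
move=> x; rewrite (loc_frac_repr x) loc_addE.
by apply/loc_fracP; exists 0%N; rewrite !exprD; ring.
Qed.

Lemma loc_addN : left_inverse loc_zero loc_opp loc_add.
Proof.
move=> x; rewrite (loc_frac_repr x) loc_oppE loc_addE.
by apply/loc_fracP; exists 0%N; rewrite !exprD; ring.
Qed.

HB.instance Definition _ :=
  GRing.isZmodule.Build loc loc_addA loc_addC loc_add0 loc_addN.

End Localization.

(* The canonical map R_f -> R_g, s / f ^+ k |-> (s * h ^+ k) / g ^+ k;
   meaningful when g = f * h. *)
Definition loc_map (R : comNzRingType) (f h g : R) (x : loc f) : loc g :=
  let u : loc_pre R := repr x in loc_frac g (u.1 * h ^+ u.2) u.2.

Lemma loc_mapE (R : comNzRingType) (f h g : R) s k : g = f * h ->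
  loc_map h g (loc_frac f s k) = loc_frac g (s * h ^+ k) k.
Proof.
move=> ->; have := loc_frac_repr (loc_frac f s k); rewrite /loc_map.
move: (repr _) => -[t j] /= /loc_fracP[l e]; apply/loc_fracP; exists l.
rewrite !exprMn; transitivity (h ^+ l * h ^+ j * h ^+ k * (f ^+ l * (f ^+ k * t))).
  by ring.
by rewrite -e; ring.
Qed.

(* S is a ring graded by gr : nat -> set S, the n-th homogeneous component
   being gr n. *)
Section LocalCohomology.
Variables (S : comNzRingType) (gr : nat -> set S).

Definition gr_int (n : int) : set S :=
  if n is Posz k then gr k else [set 0].

Definition irrelevant_ideal : set S :=
  ideal_gen (\bigcup_(n in [set n | (0 < n)%N]) gr n).

Section Cech.
Variables (r : nat) (f : 'I_r -> S) (deg : 'I_r -> nat).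

(* The Cech complex of f_1, ..., f_r: an i-cochain is a family of elements of
   the localizations of S at the products of the f_j for j in J, indexed by
   the subsets J of cardinality i; components at other J are ignored. *)
Definition cech_cochain :=
  forall J : {set 'I_r}, loc (\prod_(j in J) f j).

Definition cech_d (c : cech_cochain) : cech_cochain := fun K =>
  \sum_(j in K) loc_map (f j) (\prod_(l in K) f l) (c (K :\ j)%SET)
    *~ (-1) ^+ #|[set l in K | (l < j)%N]%SET|.

Definition cech_cocycle (i : nat) (c : cech_cochain) :=
  forall K : {set 'I_r}, #|K| = i.+1 -> cech_d c K = 0.

Definition cech_coboundary (i : nat) (c : cech_cochain) :=
  exists b, forall J : {set 'I_r}, #|J| = i -> c J = cech_d b J.

Definition cech_homogeneous (i : nat) (n : int) (c : cech_cochain) :=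
  forall J : {set 'I_r}, #|J| = i -> exists s k,
    gr_int (n + (k * \sum_(j in J) deg j)%N%:Z) s /\
    c J = loc_frac (\prod_(j in J) f j) s k.

End Cech.

(* [H^i_(S_+)(S)]_n <> 0, local cohomology being the cohomology of the Cech
   complex of a finite system of homogeneous generators of S_+. For Noetherian
   S such systems exist, and H^i does not depend on the choice of one. A class
   of degree n is represented by a homogeneous cocycle of degree n, as the
   differential has degree 0. *)
Definition local_cohomology_neq0 (i : nat) (n : int) :=
  exists r (f : 'I_r -> S) (deg : 'I_r -> nat),
    [/\ forall j, (0 < deg j)%N /\ gr (deg j) (f j),
        ideal_gen (range f) = irrelevant_ideal
      & exists c : cech_cochain f,
          [/\ cech_homogeneous deg i n c, cech_cocycle i c
            & ~ cech_coboundary i c]].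

Definition a_inv (i : nat) : \bar int := esup (local_cohomology_neq0 i).

Definition reg : \bar int :=
  supremum -oo%E [set (a_inv i + i%:Z%:E)%E | i in setT].

End LocalCohomology.

Section Filtrations.
Variable A : comNzRingType.

Record filtration := Filtration {
  fil :> nat -> set A;
  fil_ideal : forall n, is_ideal (fil n);
  fil0 : fil 0%N = setT;
  fil1 : fil 1%N <> setT;
  fil_decr : forall n, fil n.+1 `<=` fil n;
  filM : forall i j, ideal_prod (fil i) (fil j) `<=` fil (i + j)%N }.

Implicit Types (F : filtration) (J : set A).

Definition good F := exists I,
  [/\ is_ideal I, forall i, ideal_prod I (F i) `<=` F i.+1
    & exists N, forall n, (N <= n)%N -> F n.+1 = ideal_prod I (F n)].

Definition is_reduction F J :=
  [/\ is_ideal J, J `<=` F 1%N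
    & exists N, forall n, (N <= n)%N -> ideal_prod J (F n) = F n.+1].

Definition is_minimal_reduction F J :=
  is_reduction F J /\
  forall K, is_reduction F K -> K `<=` J -> K = J.

Definition fil_int F (n : int) : set A := if n is Posz k then F k else setT.

Definition reduction_number_wrt F J : \bar int :=
  esup [set n : int | fil_int F n <> ideal_prod J (fil_int F (n - 1))].

Definition reduction_number F : \bar int :=
  einf [set reduction_number_wrt F J | J in is_minimal_reduction F].

Lemma filD F n x y : F n x -> F n y -> F n (x + y).
Proof. by have [_ + _] := fil_ideal F n; exact. Qed.

Lemma filZ F n a x : F n x -> F n (a * x).
Proof. by have [_ _] := fil_ideal F n; exact. Qed.

Lemma fil_zero F n : F n 0.
Proof. by have [] := fil_ideal F n. Qed.

Lemma fil_sum F n (I : finType) (E : I -> A) :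
  (forall i, F n (E i)) -> F n (\sum_i E i).
Proof. by move=> FE; elim/big_ind: _ => //; [exact: fil_zero|exact: filD]. Qed.

Lemma filB F n x y : F n x -> F n y -> F n (x - y).
Proof. by move=> Fx Fy; apply: filD => //; rewrite -mulN1r; exact: filZ. Qed.

Lemma fil_mul F i j n x y : (i + j)%N = n -> F i x -> F j y -> F n (x * y).
Proof. by move=> <- Fx Fy; apply: filM; exact: ideal_prodM. Qed.

Lemma fil1_1 F : ~ F 1%N 1.
Proof.
move=> F1; apply: (@fil1 F); apply/seteqP; split=> // x _.
by rewrite -[x]mulr1; exact: filZ.
Qed.

(* R(F) is the subring of A[t] of the polynomials whose coefficient in each
   degree n lies in I_n. *)
Definition rees_pred F : {pred {poly A}} := fun p => `[< forall n, F n p`_n >].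

Lemma rees_subring F : subring_closed (rees_pred F).
Proof.
split=> [|p q /asboolP Fp /asboolP Fq|p q /asboolP Fp /asboolP Fq];
  apply/asboolP => n.
- rewrite coef1; case: n => [|n] /=; first by rewrite fil0.
  exact: fil_zero.
- by rewrite coefB; exact: filB.
- rewrite coefM; apply: fil_sum => i; apply: fil_mul (Fp i) (Fq _).
  by rewrite subnKC // -ltnS.
Qed.

HB.instance Definition _ F :=
  GRing.isSubringClosed.Build {poly A} (rees_pred F) (rees_subring F).

Definition rees F := {p : {poly A} | p \in rees_pred F}.
HB.instance Definition _ F := [isSub of rees F for @sval _ _].
HB.instance Definition _ F := [Choice of rees F by <:].
HB.instance Definition _ F := [SubChoice_isSubComNzRing of rees F by <:].

Lemma reesP F (p : rees F) n : F n (val p)`_n.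
Proof. by have /asboolP := valP p; exact. Qed.

Definition rees_comp F (n : nat) : set (rees F) :=
  [set p | exists c, val p = c *: 'X^n].
Arguments rees_comp : clear implicits.

(* G(F) is the quotient of R(F) by the ideal of the elements whose coefficient
   in each degree n lies in I_(n+1). *)
Definition assoc_graded_ideal F : {pred rees F} :=
  fun p => `[< forall n, F n.+1 (val p)`_n >].
Arguments assoc_graded_ideal : clear implicits.

Lemma assoc_graded_idealr F : idealr_closed (assoc_graded_ideal F).
Proof.
split=> [||p q r /asboolP Fq /asboolP Fr].
- by apply/asboolP => n; rewrite raddf0 coef0; exact: fil_zero.
- by apply/asboolP => /(_ 0%N); rewrite rmorph1 coef1; exact: fil1_1.
- apply/asboolP => n; rewrite rmorphD rmorphM coefD coefM; apply: filD => //.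
  apply: fil_sum => i; apply: fil_mul (reesP p i) (Fq _).
  by rewrite addnS subnKC // -ltnS.
Qed.

HB.instance Definition _ F :=
  isIdealr.Build (rees F) (assoc_graded_ideal F) (@assoc_graded_idealr F).

Definition assoc_graded F := {ideal_quot (assoc_graded_ideal F)}.
HB.instance Definition _ F := GRing.ComNzRing.on (assoc_graded F).

Definition assoc_graded_comp F (n : nat) : set (assoc_graded F) :=
  [set \pi_(assoc_graded F) p | p in rees_comp F n].
Arguments assoc_graded_comp : clear implicits.

(* F(F) = R(F) / m R(F), where an element a of m is seen in R(F) as the
   constant polynomial a. *)
Definition fiber_ideal (m : idealr A) F : {pred rees F} :=
  fun p => `[< ideal_gen [set q : rees F |
                 exists2 a, a \in m & val q = a%:P] p >].
Arguments fiber_ideal : clear implicits.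

Lemma fiber_idealr (m : idealr A) F : idealr_closed (fiber_ideal m F).
Proof.
have [I0 ID IM] := ideal_gen_ideal [set q : rees F |
  exists2 a, a \in m & val q = a%:P].
split=> [||p q r /asboolP Fq /asboolP Fr].
- by apply/asboolP.
- apply/asboolP => /(_ [set q : rees F | (val q)`_0 \in m]) /=.
  rewrite coef1 idealr1 => h; suff: false by [].
  apply: h; split=> [|q /= [a am ->]]; last by rewrite coefC.
  split=> [|p q pm qm|p q qm].
  + by rewrite /= coef0 rpred0.
  + by rewrite /= coefD rpredD.
  + by rewrite /= coefM big_ord1 subnn idealMr.
- by apply/asboolP; apply: ID => //; exact: IM.
Qed.

HB.instance Definition _ m F :=
  isIdealr.Build (rees F) (fiber_ideal m F) (@fiber_idealr m F).

Definition fiber_cone m F := {ideal_quot (fiber_ideal m F)}.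
HB.instance Definition _ m F := GRing.ComNzRing.on (fiber_cone m F).

Definition fiber_cone_comp m F (n : nat) : set (fiber_cone m F) :=
  [set \pi_(fiber_cone m F) p | p in rees_comp F n].
Arguments fiber_cone_comp : clear implicits.

Definition analytic_spread m F : \bar int := krull_dim (fiber_cone m F).

End Filtrations.

Arguments rees_comp {A} F n.
Arguments assoc_graded_ideal {A} F.
Arguments assoc_graded_comp {A} F n.
Arguments fiber_ideal {A} m F.
Arguments fiber_cone_comp {A} m F n.

(* Main.v *)
Require Import Defs.
From HB Require Import structures.
From mathcomp Require Import all_boot all_order all_algebra.
From mathcomp Require Import all_classical constructive_ereal ring zify.

Set Implicit Arguments.
Unset Strict Implicit.
Unset Printing Implicit Defensive.

Import Order.TTheory GRing.Theory Num.Theory.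
Local Open Scope ring_scope.
Local Open Scope classical_set_scope.

(** Both G(F) and F(F) are graded quotients S of the Rees algebra.  As the
    analytic spread is one and the residue field is infinite, every reduction
    contains an element x that generates a reduction by itself
    ([reduction_principal]).  Multiplication by x is then onto in high degrees
    of S, so S_+ and x S have the same radical, and the local cohomology of S
    is that of the complex S -> S_x: H^0 is the x-power torsion of S, H^1 is
    the cokernel S_x / S, and the higher modules vanish.  Let r be the
    reduction number with respect to x.  By Nakayama's lemma and the inclusion
    of I_(n+1) in m I_n, r is for both rings the last degree n in which S_n
    differs from x S_(n-1).  Hence reg S is the maximum of r and of
    the degrees of the x-torsion elements ([rees_quot_reg_le],
    [rees_quot_torsion_le_reg], [rees_quot_generator_le_reg]): a homogeneous s
    of degree r outside x S either has s / x outside the image of S, which is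
    a class of H^1 in degree r - 1, or differs from a multiple of x by a
    torsion element of degree r.

    It remains to compare torsion.  Let n > r and let a in I_n, outside m I_n,
    satisfy x^p a in m I_(n+p).  Since I_(n+p) = x^p I_n, there is b in m I_n
    with x^p a = x^p b, and a - b defines a torsion element of G(F) in the same
    degree, nonzero because I_(n+1) is contained in m I_n.  This gives the
    inequality.  If grade I_1 = 1 then x is a nonzerodivisor, and
    x^p a in I_(n+p+1) = x^p I_(n+1) forces a in I_(n+1): above degree r there
    is no torsion in G(F), and reg G(F) = r.  Every minimal reduction is
    generated by such an x and such an x generates a minimal reduction, so r is
    also the reduction number of the filtration.

    The local cohomology is computed directly on an arbitrary Cech complex.
    A cocycle is a family of numerators over a common denominator on which the
    usual contracting homotopy ([num_homotopy]) works for any partition of a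
    power of x, and x is a unit in all localizations but that at the empty
    product ([cech_nonzero_cases]).

    The element x is found by lowering the number of linear generators of an
    ideal of F(F) that contains all high degrees ([linear_parameter]).  Two
    linear forms x1, x2 satisfy a relation g(x1, x2) = 0
    ([forms_relation]); for a scalar c with g(c, 1) nonzero, x1 - c x2 divides
    a power of x2, hence can replace both.  Without a relation, a homogeneous
    prime P0 avoiding all nonzero forms in x1, x2 and a homogeneous prime P1
    containing P0 and x1 would give a chain P0 < P1 < S_+; here P1 exists
    because otherwise P0 + (x1) would contain all high degrees, so that the
    graded pieces of S / P0 would have bounded dimension, although the monomials
    of any given degree in x1, x2 are independent there. *)

(** * Ideals, primes and Nakayama's lemma *)

Section Ideals.
Variable R : comNzRingType.
Implicit Types (I J K P T X Y : set R) (s : seq R) (x y z a b : R).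

Section IdealAxioms.
Variables (I : set R) (idI : is_ideal I).

Lemma ideal0 : I 0. Proof. by case: idI. Qed.

Lemma idealD x y : I x -> I y -> I (x + y).
Proof. by case: idI => _ + _; exact. Qed.

Lemma idealM a x : I x -> I (a * x).
Proof. by case: idI => _ _; exact. Qed.

Lemma ideal_mulr x a : I x -> I (x * a).
Proof. by rewrite mulrC; exact: idealM. Qed.

Lemma idealN x : I x -> I (- x).
Proof. by rewrite -mulN1r; exact: idealM. Qed.

Lemma idealB x y : I x -> I y -> I (x - y).
Proof. by move=> Ix Iy; apply: idealD => //; exact: idealN. Qed.

Lemma ideal_sum (U : Type) (r : seq U) (Q : pred U) (E : U -> R) :
  (forall u, Q u -> I (E u)) -> I (\sum_(u <- r | Q u) E u).
Proof.
by move=> IE; elim/big_ind: _ => //; [exact: ideal0|exact: idealD].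
Qed.

Lemma ideal_subr x y : I y -> I (x - y) -> I x.
Proof. by move=> Iy Ixy; rewrite -(subrK y x); exact: idealD. Qed.

Lemma ideal_eqT : I 1 -> I = setT.
Proof.
by move=> I1; apply/seteqP; split=> // x _; rewrite -[x]mulr1; exact: idealM.
Qed.

Lemma ideal_proper : I <> setT -> ~ I 1.
Proof. by move=> + /ideal_eqT. Qed.

End IdealAxioms.

Lemma ideal_gen_sub X I : is_ideal I -> X `<=` I -> ideal_gen X `<=` I.
Proof. by move=> idI XI x; exact. Qed.

Lemma sub_ideal_gen X : X `<=` ideal_gen X.
Proof. by move=> x Xx I [_]; exact. Qed.

(** The ideal I + (y), explicit so that membership yields the quotient. *)
Definition adjoin I y : set R := [set s | exists z, I (s - y * z)].

Definition adjoins I s : set R := foldr (fun y K => adjoin K y) I s.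

Lemma adjoin_ideal I y : is_ideal I -> is_ideal (adjoin I y).
Proof.
move=> idI; split=> [|s t [z Iz] [w Iw]|a s [z Iz]].
- by exists 0; rewrite mulr0 subr0; exact: ideal0.
- by exists (z + w); rewrite mulrDr opprD addrACA; exact: idealD.
- by exists (a * z); rewrite mulrCA -mulrBr; exact: idealM.
Qed.

Lemma sub_adjoin I y : I `<=` adjoin I y.
Proof. by move=> s Is; exists 0; rewrite mulr0 subr0. Qed.

Lemma mem_adjoin I y z : is_ideal I -> adjoin I y (y * z).
Proof. by move=> idI; exists z; rewrite subrr; exact: ideal0. Qed.

Lemma adjoin_sub I J y : is_ideal J -> I `<=` J -> J y -> adjoin I y `<=` J.
Proof.
move=> idJ IJ Jy s [z /IJ]; apply: ideal_subr => //.
exact: ideal_mulr.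
Qed.

Lemma adjoins_ideal I s : is_ideal I -> is_ideal (adjoins I s).
Proof. by move=> idI; elim: s => //= y s IH; exact: adjoin_ideal. Qed.

Lemma sub_adjoins I s : I `<=` adjoins I s.
Proof. by elim: s => //= y s IH; apply: subset_trans IH (@sub_adjoin _ _). Qed.

Lemma mem_adjoins I s y : is_ideal I -> y \in s -> adjoins I s y.
Proof.
move=> idI; elim: s => //= x s IH; rewrite inE => /predU1P[->|/IH].
  by rewrite -[x in adjoin _ _ x]mulr1; exact/mem_adjoin/adjoins_ideal.
exact: sub_adjoin.
Qed.

Lemma adjoins_sub I J s : is_ideal J -> I `<=` J -> [set` s] `<=` J ->
  adjoins I s `<=` J.
Proof.
move=> idJ IJ; elim: s => //= y s IH sJ; apply: adjoin_sub => //.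
  by apply: IH => x xs; apply: sJ; rewrite /= inE xs orbT.
by apply: sJ; rewrite /= mem_head.
Qed.

Lemma zero_ideal : is_ideal ([set 0] : set R).
Proof.
by split=> [|x y -> ->|a x ->] //=; rewrite ?addr0 ?mulr0.
Qed.

Lemma ideal_gen_seq s : ideal_gen [set` s] = adjoins [set 0] s.
Proof.
have id0 := adjoins_ideal s zero_ideal; apply/seteqP; split.
  by apply: ideal_gen_sub => // x xs; apply: mem_adjoins => //; exact: zero_ideal.
have idg := @ideal_gen_ideal R [set` s].
apply: adjoins_sub => //; last exact: sub_ideal_gen.
by move=> _ ->; exact: ideal0.
Qed.

Lemma ideal_gen1 x z : ideal_gen [set x] z <-> exists a, z = x * a.
Proof.
have -> : [set x] = [set` [:: x]].
  by apply/seteqP; split=> y /=; rewrite inE => /eqP.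
rewrite ideal_gen_seq /=; split=> [[a /eqP]|[a ->]].
  by rewrite subr_eq0 => /eqP; exists a.
by apply: mem_adjoin; exact: zero_ideal.
Qed.

Lemma ideal_gen_range (I : finType) (f : I -> R) z :
  ideal_gen (range f) z <-> exists g : I -> R, z = \sum_j g j * f j.
Proof.
split=> [|[g ->]]; last first.
  have idf := @ideal_gen_ideal R (range f).
  apply: (ideal_sum idf) => j _; apply: (idealM idf).
  by apply: sub_ideal_gen; exists j.
move: z; apply: ideal_gen_sub.
  split=> [|x y [g ->] [h ->]|a x [g ->]].
  - by exists (fun=> 0); rewrite big1 // => j _; rewrite mul0r.
  - exists (fun j => g j + h j); rewrite -big_split /=.
    by apply: eq_bigr => j _; rewrite mulrDl.
  - exists (fun j => a * g j); rewrite big_distrr /=.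
    by apply: eq_bigr => j _; rewrite mulrA.
move=> _ [j _ <-]; exists (fun i => (i == j)%:R).
rewrite (bigD1 j) //= eqxx mul1r big1 ?addr0 // => i /negPf ->.
by rewrite mul0r.
Qed.

Lemma ideal_prod_ideal I J : is_ideal (ideal_prod I J).
Proof. exact: ideal_gen_ideal. Qed.

Lemma ideal_prod_sub I J K : is_ideal K ->
  (forall x y, I x -> J y -> K (x * y)) -> ideal_prod I J `<=` K.
Proof.
by move=> idK IJK; apply: (ideal_gen_sub idK) => _ [x Ix [y Jy <-]]; exact: IJK.
Qed.

Lemma ideal_prod1 x J z : is_ideal J ->
  ideal_prod (ideal_gen [set x]) J z <-> exists2 y, J y & z = x * y.
Proof.
move=> idJ; split=> [|[y Jy ->]]; last first.
  by apply: ideal_prodM => //; exact: sub_ideal_gen.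
move: z; apply: ideal_prod_sub.
  split=> [|u v [y Jy ->] [w Jw ->]|a u [y Jy ->]].
  - by exists 0; rewrite ?mulr0 //; exact: ideal0.
  - by exists (y + w); rewrite ?mulrDr //; exact: idealD.
  - by exists (a * y); [exact: idealM|rewrite mulrCA].
move=> u y /ideal_gen1[a ->] Jy; exists (a * y); rewrite ?mulrA //.
exact: idealM.
Qed.

Definition radical I : set R := [set x | exists n, I (x ^+ n)].

Lemma radical_ideal I : is_ideal I -> is_ideal (radical I).
Proof.
move=> idI; split=> [|x y [m Im] [n In]|a x [n In]].
- by exists 1%N; rewrite expr1; exact: ideal0.
- exists (m + n)%N; rewrite exprDn; apply: ideal_sum => // i _.
  rewrite -mulr_natl; apply: (idealM idI).
  have [mi|im] := leqP m (m + n - i).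
    by rewrite -(subnK mi) exprD mulrC mulrCA mulrA; apply: idealM.
  have ni : (n <= i)%N by have := ltn_ord i; lia.
  by rewrite -(subnK ni) exprD mulrA; apply: idealM.
- by exists n; rewrite exprMn; exact: idealM.
Qed.

(** Radicals turn a combination of the f j into one of their N-th powers, for
    a suitable power of the element; N is only known after denominators have
    been cleared, hence the quantification over all N. *)
Lemma radical_gen_pow (I : finType) (f : I -> R) z N :
  ideal_gen (range f) z ->
  exists p (g : I -> R), z ^+ p = \sum_j g j * f j ^+ N.
Proof.
move=> fz.
suff [p] : radical (ideal_gen (range (fun j => f j ^+ N))) z.
  by move=> /ideal_gen_range[g e]; exists p, g.
move: z fz; apply: ideal_gen_sub; first exact/radical_ideal/ideal_gen_ideal.
by move=> _ [j _ <-]; exists N; apply: sub_ideal_gen; exists j.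
Qed.

(** Zorn's lemma; the empty set is added to the family so that empty chains
    have an upper bound. With T reduced to 1 it gives maximal ideals, with T
    multiplicative it gives primes. *)
Lemma ideal_avoid_max I T : is_ideal I -> T 1 -> I `&` T = set0 ->
  exists P, [/\ is_ideal P, I `<=` P, P `&` T = set0
    & forall J, is_ideal J -> P `<=` J -> J `&` T = set0 -> J = P].
Proof.
move=> idI T1 IT.
pose good X := [/\ is_ideal X, I `<=` X & X `&` T = set0].
pose Q X := X = set0 \/ good X.
have [F FQ Ftot|P [QP Pmax]] := @Zorn_bigcup R Q.
  have [[X FX [x Xx]]|none] := pselect (exists2 X, F X & X !=set0); last first.
    left; apply/seteqP; split=> // x [X FX Xx]; apply: none.
    by exists X => //; exists x.
  right; have gX : good X.
    by case: (FQ X FX) => // X0; move: Xx; rewrite X0.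
  have gd Y y : F Y -> Y y -> good Y.
    by move=> FY Yy; case: (FQ Y FY) => // Y0; move: Yy; rewrite Y0.
  case: gX => idX IX XT; split; last first.
  - apply/seteqP; split=> // y [[Y FY Yy] Ty].
    by have [_ _ <-] := gd Y y FY Yy; split.
  - by move=> y Iy; exists X => //; exact: IX.
  - split=> [|a b [Y FY Ya] [Z FZ Zb]|a b [Y FY Yb]].
    + by exists X => //; exact: ideal0.
    + have [idY _ _] := gd _ _ FY Ya; have [idZ _ _] := gd _ _ FZ Zb.
      have [YZ|ZY] := Ftot Y Z FY FZ.
        by exists Z => //; apply: idealD => //; exact: YZ.
      by exists Y => //; apply: idealD => //; exact: ZY.
    + by exists Y => //; have [idY _ _] := gd _ _ FY Yb; exact: idealM.
have gI : good I by split.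
have [idP IP PT] : good P.
  case: QP => // P0; exfalso; apply: (Pmax I); last by right.
  by rewrite P0; split=> // /(_ _ (ideal0 idI)).
exists P; split=> // J idJ PJ JT; apply: contrapT => JP.
apply: (Pmax J); last by right; split=> //; exact: subset_trans IP PJ.
by split=> // JP'; apply: JP; apply/seteqP.
Qed.

Lemma ideal_avoid_prime I T : is_ideal I -> T 1 ->
  (forall x y, T x -> T y -> T (x * y)) -> I `&` T = set0 ->
  exists P, [/\ is_prime P, I `<=` P & P `&` T = set0].
Proof.
move=> idI T1 TM IT.
have [P [idP IP PT Pmax]] := ideal_avoid_max idI T1 IT.
have meet a : ~ P a -> exists2 t, T t & adjoin P a t.
  move=> Pa; apply: contrapT => no; apply: Pa.
  rewrite -(Pmax (adjoin P a)); first by rewrite -[a in _ a]mulr1; exact: mem_adjoin.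
  - exact: adjoin_ideal.
  - exact: sub_adjoin.
  - by apply/seteqP; split=> // t [at_ Tt]; apply: no; exists t.
exists P; split=> //; split=> //.
  by move=> PT'; have : (P `&` T) 1 by [rewrite PT'; split]; rewrite PT.
move=> a b Pab; apply: contrapT => /not_orP[/meet[t Tt [z Pz]] /meet[u Tu [w Pw]]].
have : (P `&` T) (t * u); last by rewrite PT.
split; last exact: TM.
apply: (@ideal_subr _ idP _ (a * z * u)); last first.
  by rewrite -mulrBl; exact: ideal_mulr.
apply: (@ideal_subr _ idP _ (a * z * (b * w))).
  rewrite (_ : _ * _ = a * b * (z * w)); last by ring.
  exact: ideal_mulr.
by rewrite -mulrBr; exact: idealM.
Qed.

Section Local.
Variables (m : idealr R) (locR : local_ring m).

Lemma local_unit a : a \notin m -> exists b, b * a = 1.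
Proof.
move=> am; apply: contrapT => nu.
have idg := @ideal_gen_ideal R [set a].
have [||P [idP aP P1 Pmax]] := @ideal_avoid_max (ideal_gen [set a]) [set 1] idg.
- by [].
- apply/seteqP; split=> // x [/ideal_gen1[b ->]] ab; apply: nu.
  by exists b; rewrite mulrC.
have Pm : is_maximal P.
  split=> //.
    by move=> PT; have : (P `&` [set 1]) 1 by [rewrite PT]; rewrite P1.
  move=> J idJ PJ; have [J1|nJ1] := pselect (J 1).
    by right; exact: ideal_eqT.
  by left; apply: Pmax => //; apply/seteqP; split=> // x [Jx x1]; rewrite x1 in Jx.
have : P a by apply: aP; exact: sub_ideal_gen.
by rewrite (locR P).1 //= (negPf am).
Qed.

Lemma local_unitB a : a \in m -> exists b, b * (1 - a) = 1.
Proof.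
move=> am; apply: local_unit; apply/negP => h.
by have := rpredD h am; rewrite subrK idealr1.
Qed.

(** The generators of M are removed one by one: modulo N and the remaining
    ones, a generator y equals a multiple of itself by an element of m. *)
Lemma nakayama M N s : is_ideal N -> M = ideal_gen [set` s] ->
  (forall z, M z -> exists2 w, ideal_prod [set` m] M w & N (z - w)) ->
  M `<=` N.
Proof.
move=> idN Ms MN.
have idM : is_ideal M by rewrite Ms; exact: ideal_gen_ideal.
suff H t : [set` t] `<=` M -> M `<=` adjoins N t -> M `<=` N.
  apply: (H s); rewrite Ms; first exact: sub_ideal_gen.
  by apply: ideal_gen_sub; [exact: adjoins_ideal|move=> x; exact: mem_adjoins].
elim: t => [//|y t IH] ytM MNyt.
have tM : [set` t] `<=` M by move=> x xt; apply: ytM; rewrite /= inE xt orbT.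
have My : M y by apply: ytM; rewrite /= mem_head.
apply: IH => //.
have idNt := adjoins_ideal t idN.
suff Nty : adjoins N t y by apply: subset_trans MNyt _; exact: adjoin_sub.
have [w mw Nyw] := MN y My.
have [a am aw] : exists2 a, a \in m & adjoins N t (w - y * a).
  move: w mw {Nyw}; apply: ideal_prod_sub.
    split=> [|u v [a am ua] [b bm vb]|c u [a am ua]].
    - by exists 0; rewrite ?rpred0 // mulr0 subr0; exact: ideal0.
    - exists (a + b); first exact: rpredD.
      by rewrite mulrDr opprD addrACA; exact: idealD.
    - exists (c * a); first exact: idealMr.
      by rewrite mulrCA -mulrBr; exact: idealM.
  move=> a z am /MNyt[c zc]; exists (c * a); first exact: idealMr.
  by rewrite mulrA [_ * a]mulrC -mulrBr; exact: idealM.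
have [b b1] := local_unitB am.
rewrite -[y]mul1r -b1 -mulrA; apply: (idealM idNt).
apply: (ideal_subr idNt aw).
rewrite (_ : _ - _ = y - w); last by ring.
exact: sub_adjoins.
Qed.

End Local.
End Ideals.

(** * Suprema in the extended integers and regularity *)

Section Suprema.
Implicit Types (E : set (\bar int)) (B : \bar int).

(** Completeness of the extended integers comes from the well-ordering of nat,
    applied to the distance from a finite element of E. *)
Lemma int_ereal_lub E : exists B, ubound E B /\ forall C, ubound E C -> (B <= C)%E.
Proof.
have [Ey|Ey] := pselect (E +oo%E).
  by exists +oo%E; split=> [b _|C /(_ _ Ey) //]; rewrite leey.
have [[n En]|none] := pselect (exists n, E n%:E); last first.
  exists -oo%E; split=> [[b|//|//] Eb|C _]; last by rewrite leNye.
  by case: none; exists b.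
have [[k0 ubk]|unb] := pselect (exists k : nat, ubound E (n + k%:Z)%:E).
  have ex : exists k : nat, `[< ubound E (n + k%:Z)%:E >] by exists k0; apply/asboolP.
  case: (ex_minnP ex) => k /asboolP ubE kmin.
  exists (n + k%:Z)%:E; split=> // -[c||] Ec; [|by rewrite leey|by have := Ec _ En].
  have nc : (n <= c)%R by have := Ec _ En; rewrite lee_fin.
  rewrite lee_fin -(subrKC n c) lerD2l -(@gez0_abs (c - n)) ?subr_ge0 // lez_nat.
  by apply: kmin; apply/asboolP; rewrite gez0_abs ?subr_ge0 // subrKC.
exists +oo%E; split=> [b _|[c||] Ec //]; [by rewrite leey| |by have := Ec _ En].
have nc : (n <= c)%R by have := Ec _ En; rewrite lee_fin.
case: unb; exists `|c - n|%N.
by rewrite gez0_abs ?subr_ge0 // subrKC.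
Qed.

Lemma int_supremumP E : ubound E (supremum -oo%E E) /\
  forall C, ubound E C -> (supremum -oo%E E <= C)%E.
Proof.
rewrite /supremum; case: ifPn => [/eqP ->|_].
  by split=> // C _; rewrite leNye.
have [B [ubB Bl]] := int_ereal_lub E.
case: xgetP => [C _ [ubC Cl]|/(_ B)[]]; last by [].
by split=> // D; exact: Cl.
Qed.

Lemma esup_ub (E : set int) n : E n -> (n%:E <= esup E)%E.
Proof. by move=> En; apply: (int_supremumP _).1; exists n. Qed.

Lemma esup_le (E : set int) B : (forall n, E n -> n%:E <= B)%E -> (esup E <= B)%E.
Proof. by move=> EB; apply: (int_supremumP _).2 => _ [n En <-]; exact: EB. Qed.

Lemma esup_max (E : set int) n : E n -> (forall k, E k -> k <= n) ->
  esup E = n%:E.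
Proof.
move=> En maxn; apply/le_anti; rewrite esup_ub // andbT.
by apply: esup_le => k /maxn; rewrite lee_fin.
Qed.

Lemma einf1 B : einf [set B] = B.
Proof.
rewrite /einf /infimum ifF; last first.
  by apply/eqP; rewrite predeqE => /(_ B)[+ _]; apply.
by rewrite infimums1; case: xgetP => // /(_ B) /(_ erefl).
Qed.

Section Regularity.
Variables (S : comNzRingType) (gr : nat -> set S).

Lemma reg_ub i n : local_cohomology_neq0 gr i n -> ((n + i%:Z)%:E <= reg gr)%E.
Proof.
move=> Hin; apply: (@le_trans _ _ (a_inv gr i + i%:Z%:E)%E).
  by rewrite EFinD leeD2r // esup_ub.
by apply: (int_supremumP _).1; exists i.
Qed.

Lemma reg_le B :
  (forall i n, local_cohomology_neq0 gr i n -> ((n + i%:Z)%:E <= B)%E) ->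
  (reg gr <= B)%E.
Proof.
move=> HB; apply: (int_supremumP _).2 => _ [i _ <-].
case: B HB => [b||] HB; rewrite ?leey //.
- suff : (a_inv gr i <= (b - i%:Z)%:E)%E.
    by case: (a_inv gr i) => [a||] //; rewrite ?addNye ?leNye // -EFinD !lee_fin lerBrDr.
  by apply: esup_le => n /HB; rewrite !lee_fin lerBrDr.
- suff : (a_inv gr i <= -oo)%E by rewrite leeNy_eq => /eqP ->; rewrite addNye.
  by apply: esup_le => n /HB.
Qed.

End Regularity.
End Suprema.

(** * Numerators of Cech cochains *)

Section LocFrac.
Variables (S : comNzRingType) (f : S).

Lemma loc_frac0 k : loc_frac f 0 k = 0.
Proof. by apply/loc_fracP; exists 0%N; rewrite !mulr0. Qed.

Lemma loc_fracD a b k : loc_frac f (a + b) k = loc_frac f a k + loc_frac f b k.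
Proof.
rewrite [RHS]loc_addE; apply/loc_fracP; exists 0%N; rewrite exprD; ring.
Qed.

Lemma loc_fracN a k : loc_frac f (- a) k = - loc_frac f a k.
Proof. by rewrite [RHS]loc_oppE. Qed.

Lemma loc_frac_signed_sum (I : finType) (K : {set I}) (a : I -> S) (e : I -> nat) k :
  \sum_(j in K) loc_frac f (a j) k *~ (-1) ^+ e j =
  loc_frac f (\sum_(j in K) (-1) ^+ e j * a j) k.
Proof.
rewrite (big_morph (loc_frac f ^~ k) (fun a b => loc_fracD a b k) (loc_frac0 k)).
apply: eq_bigr => j _; rewrite -signr_odd -[in RHS]signr_odd.
by case: (odd _); rewrite ?expr1 ?expr0 ?mul1r // mulN1r loc_fracN.
Qed.

Lemma loc_frac_expand a k l : loc_frac f a k = loc_frac f (a * f ^+ l) (k + l).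
Proof. by apply/loc_fracP; exists 0%N; rewrite exprD; ring. Qed.

Lemma loc_frac_eq0 a k : (exists l, f ^+ l * a = 0) <-> loc_frac f a k = 0.
Proof.
rewrite -(loc_frac0 0); split=> [[l e]|/loc_fracP[l]].
  by apply/loc_fracP; exists l; rewrite expr0 mul1r e !mulr0.
by rewrite expr0 mul1r !mulr0 => e; exists l.
Qed.

(** If y divides a power of f, it is a unit of the localization. *)
Lemma loc_frac_cancel y w q a b k l : f ^+ q = y * w ->
  y * (f ^+ l * a) = y * (f ^+ k * b) -> loc_frac f a k = loc_frac f b l.
Proof.
move=> fy e; apply/loc_fracP; exists q; rewrite fy.
transitivity (w * (y * (f ^+ l * a))); first by ring.
by rewrite e; ring.
Qed.

End LocFrac.

Section CechComplex.
Variables (S : comNzRingType) (r : nat) (f : 'I_r -> S).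
Implicit Types (J K L : {set 'I_r}) (s : {set 'I_r} -> S).

Local Notation pr J := (\prod_(j in J) f j).

Definition cech_sign (j : 'I_r) K : nat := (\sum_(l in K) (l < j))%N.

Lemma cech_signE (j : 'I_r) K : #|[set l in K | (l < j)%N]%SET| = cech_sign j K.
Proof.
rewrite /cech_sign -sum1_card big_mkcond [RHS]big_mkcond /=.
by apply: eq_bigr => l _; rewrite inE; case: (l \in K) (l < j)%N => [] [].
Qed.

(** The Cech differential acting on numerators over a common denominator, of
    exponent N at each place. *)
Definition num_d N s K : S :=
  \sum_(j in K) (-1) ^+ cech_sign j K * (f j ^+ N * s (K :\ j)%SET).

Lemma prodD1 K j : j \in K -> pr K = pr (K :\ j)%SET * f j.
Proof. by move=> jK; rewrite (big_setD1 j) //= mulrC. Qed.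

Lemma cech_dE (c : cech_cochain f) s N K :
  (forall j, j \in K -> c (K :\ j)%SET = loc_frac _ (s (K :\ j)%SET) N) ->
  cech_d c K = loc_frac (pr K) (num_d N s K) N.
Proof.
move=> cs; rewrite /cech_d -loc_frac_signed_sum; apply: eq_bigr => j jK.
by rewrite cs // (loc_mapE _ _ (prodD1 jK)) cech_signE mulrC.
Qed.

Definition cochain_of s N : cech_cochain f := fun J => loc_frac (pr J) (s J) N.

Lemma cech_d_cochain_of s N K :
  cech_d (cochain_of s N) K = loc_frac (pr K) (num_d N s K) N.
Proof. exact: cech_dE. Qed.

Lemma cech_d_set0 (c : cech_cochain f) : cech_d c finset.set0 = 0.
Proof. exact: big_set0. Qed.

(** Adding j and removing k in the two possible orders gives opposite signs:
    exactly one of j < k and k < j contributes an extra sign. *)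
Lemma cech_sign_swap J j k : k \in J -> j \notin J ->
  (-1) ^+ cech_sign k J * (-1) ^+ cech_sign j (j |: (J :\ k))%SET =
  - ((-1) ^+ cech_sign j (j |: J)%SET * (-1) ^+ cech_sign k (j |: J)%SET) :> S.
Proof.
move=> kJ jJ; have jk : j != k by apply: contraNneq jJ => ->.
have jJk : j \notin (J :\ k)%SET by rewrite !inE negb_and jJ orbT.
rewrite /cech_sign !(big_setU1 _ jJ) (big_setU1 _ jJk) /=.
rewrite [in X in - (X * _)](big_setD1 k kJ) /= ltnn !add0n !exprD.
set a := \sum_(l in J) _; set b := \sum_(l in _ :\ k) _.
case: ltngtP jk => [_ _|_ _|/val_inj ->]; rewrite ?eqxx // ?(expr0, expr1); ring.
Qed.

(** The contracting homotopy of the Cech complex attached to coefficients g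
    with [\sum_j g j * f j ^+ N] invertible. *)
Definition num_h (g : 'I_r -> S) s L : S :=
  \sum_(j | j \notin L)
    (-1) ^+ cech_sign j (j |: L)%SET * (g j * s (j |: L)%SET).

Lemma sqr_sign n : (-1) ^+ n * (-1) ^+ n = 1 :> S.
Proof. by rewrite -exprMn mulrNN mulr1 expr1n. Qed.

(** In the homotopy identity dh + hd = D, the term hd vanishes on cocycles. It
    is stated for numerators, where it holds exactly in S. *)
Lemma num_homotopy g s N i :
  (forall K, #|K| = i.+1 -> num_d N s K = 0) ->
  forall J, #|J| = i ->
  num_d N (num_h g s) J = (\sum_j g j * f j ^+ N) * s J.
Proof.
move=> s_cocycle J cardJ.
transitivity (\sum_(k in J) (g k * f k ^+ N * s J) +
  \sum_(j | j \notin J) \sum_(k in J)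
    (-1) ^+ cech_sign k J * (f k ^+ N *
     ((-1) ^+ cech_sign j (j |: (J :\ k))%SET * (g j * s (j |: (J :\ k))%SET)))).
  rewrite exchange_big /= -big_split /=; apply: eq_bigr => k kJ.
  rewrite /num_h (bigD1 k) /=; last by rewrite !inE eqxx.
  rewrite finset.setD1K // mulrDr mulrDr; congr (_ + _).
    set e := (-1) ^+ _; transitivity (e * e * (g k * f k ^+ N * s J)); first by ring.
    by rewrite sqr_sign mul1r.
  rewrite !big_distrr /=; apply: eq_bigl => j; rewrite !inE negb_and negbK.
  by case: eqVneq => [->|] //=; rewrite ?kJ ?andbT // andbF.
rewrite [RHS]big_distrl [RHS](bigID [in J]) /=; congr (_ + _).
apply: eq_bigr => j jJ.
have := s_cocycle (j |: J)%SET; rewrite cardsU1 jJ cardJ add1n => /(_ erefl).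
rewrite /num_d (big_setU1 _ jJ) /= finset.setU1K // => /eqP; rewrite addr_eq0 => /eqP e.
transitivity (- ((-1) ^+ cech_sign j (j |: J)%SET * g j) *
  \sum_(k in J) (-1) ^+ cech_sign k (j |: J)%SET *
     (f k ^+ N * s ((j |: J) :\ k)%SET)).
  rewrite big_distrr /=; apply: eq_bigr => k kJ.
  have -> : ((j |: J) :\ k = j |: (J :\ k))%SET.
    apply/setP => l; rewrite !inE; have [->|//] := eqVneq l j.
    by rewrite orTb andbT; apply: contraNneq jJ => ->.
  transitivity ((-1) ^+ cech_sign k J * (-1) ^+ cech_sign j (j |: (J :\ k))%SET *
    (f k ^+ N * (g j * s (j |: (J :\ k))%SET))); first by ring.
  by rewrite cech_sign_swap //; ring.
rewrite mulNr -mulrN -e.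
set t := (-1) ^+ _; transitivity (t * t * (g j * f j ^+ N * s J)); first by ring.
by rewrite sqr_sign mul1r.
Qed.

End CechComplex.

(** * Local cohomology when S_+ is the radical of a linear form *)

(** A grading is carried by its component functions; being total and
    compatible with gr, they determine the direct sum decomposition. *)
Record grading (S : comNzRingType) (gr : nat -> set S) := Grading {
  cmp : nat -> S -> S;
  cmpD : forall n, {morph cmp n : s t / s + t};
  cmp_gr : forall n s, gr n (cmp n s);
  cmp_id : forall n s, gr n s -> cmp n s = s;
  cmp_neq : forall n k s, gr n s -> k != n -> cmp k s = 0;
  cmp_total : forall s, exists N, s = \sum_(i < N) cmp i s;
  gr1 : gr 0%N 1;
  grM : forall i j s t, gr i s -> gr j t -> gr (i + j)%N (s * t) }.

Section GradedRings.
Variables (S : comNzRingType) (gr : nat -> set S) (G : grading gr).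
Local Notation cmp := (cmp G).
Local Notation grM := (grM G).

Lemma cmp0 n : cmp n 0 = 0.
Proof. by apply: (addrI (cmp n 0)); rewrite -cmpD !addr0. Qed.

Lemma cmpN n s : cmp n (- s) = - cmp n s.
Proof. by apply/eqP; rewrite -addr_eq0 -cmpD addNr cmp0. Qed.

Lemma cmpB n s t : cmp n (s - t) = cmp n s - cmp n t.
Proof. by rewrite cmpD cmpN. Qed.

Lemma cmp_sum n (I : Type) (u : seq I) (Q : pred I) (E : I -> S) :
  cmp n (\sum_(i <- u | Q i) E i) = \sum_(i <- u | Q i) cmp n (E i).
Proof. exact: (big_morph _ (cmpD G n) (cmp0 n)). Qed.

Lemma gr0 n : gr n 0.
Proof. by rewrite -(cmp0 n); exact: cmp_gr. Qed.

Lemma grX d n s : gr d s -> gr (d * n)%N (s ^+ n).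
Proof.
move=> ds; elim: n => [|n IH]; first by rewrite muln0 expr0; exact: gr1.
by rewrite mulnS exprS; exact: grM.
Qed.

Lemma cmp_cmp n k s : cmp n (cmp k s) = if n == k then cmp k s else 0.
Proof.
case: eqP => [->|/eqP nk]; first exact: (cmp_id G (cmp_gr G _ _)).
exact: (cmp_neq G (cmp_gr G k s) nk).
Qed.

Lemma cmpMl d n a s : gr d a -> cmp (d + n) (a * s) = a * cmp n s.
Proof.
move=> da; have [N e] := cmp_total G s.
rewrite [in LHS]e [in RHS]e !(big_distrr, cmp_sum) /=; apply: eq_bigr => i _.
rewrite cmp_cmp; have ai := grM da (cmp_gr G i s).
case: eqP => [->|/eqP ni]; first exact: cmp_id.
by rewrite mulr0 (cmp_neq G ai) // eqn_add2l.
Qed.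

Lemma cmpMl_lt d k a s : gr d a -> (k < d)%N -> cmp k (a * s) = 0.
Proof.
move=> da kd; have [N ->] := cmp_total G s.
rewrite big_distrr cmp_sum big1 //= => i _.
by apply: (cmp_neq G (grM da (cmp_gr G i s))); rewrite neq_ltn ltn_addr.
Qed.

Lemma gr_intM n d s a :
  gr_int gr n s -> gr d a -> gr_int gr (n + d%:Z) (s * a).
Proof.
case: n => [n|n] /= ns da; first exact: grM ns da.
have -> : s * a = 0 by rewrite ns mul0r.
by case: (_ + _) => k //=; exact: gr0.
Qed.

Lemma gr_prod (r : nat) (f : 'I_r -> S) (deg : 'I_r -> nat) (J : {set 'I_r}) k :
  (forall j, gr (deg j) (f j)) ->
  gr (k * \sum_(j in J) deg j)%N ((\prod_(j in J) f j) ^+ k).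
Proof.
move=> fd; rewrite mulnC; apply: grX.
apply: (big_ind2 (fun n s => gr n s)) => //; first exact: gr1.
by move=> ? ? ? ?; exact: grM.
Qed.

Section LocalCohomology.
Variables (x : S) (r0 : nat).
Hypothesis x_deg : gr 1%N x.
Hypothesis x_surj : forall n s, (r0 <= n)%N -> gr n.+1 s ->
  exists2 t, gr n t & s = x * t.

Lemma x_surj_pow k n s : (r0 <= n)%N -> gr (n + k)%N s ->
  exists2 t, gr n t & s = x ^+ k * t.
Proof.
move=> rn; elim: k s => [|k IH] s.
  by rewrite addn0 => ns; exists s; rewrite ?expr0 ?mul1r.
rewrite addnS => /x_surj[|t /IH[u nu ->] ->]; first exact: leq_trans (leq_addr _ _).
by exists u => //; rewrite exprS mulrA.
Qed.

Section System.
Variables (r : nat) (f : 'I_r -> S) (deg : 'I_r -> nat).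
Hypothesis f_deg : forall j, (0 < deg j)%N /\ gr (deg j) (f j).
Hypothesis f_gen : ideal_gen (range f) = irrelevant_ideal gr.

Local Notation pr J := (\prod_(j in J) f j).
Local Notation dg J := (\sum_(j in J) deg j)%N.
Implicit Types J K : {set 'I_r}.

Lemma x_pow_comb N : exists p (g : 'I_r -> S), x ^+ p = \sum_j g j * f j ^+ N.
Proof.
apply: radical_gen_pow; rewrite f_gen.
by apply: sub_ideal_gen; exists 1%N.
Qed.

(** Every generator of S_+ has a power divisible by any given power of x,
    because multiplication by x is onto above degree r0. *)
Lemma f_pow_div k j :
  exists2 h, gr ((r0 + k) * deg j - k)%N h & f j ^+ (r0 + k) = x ^+ k * h.
Proof.
have [d0 fj] := f_deg j.
apply: x_surj_pow; first by rewrite leq_subRL; nia.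
by rewrite subnK; [rewrite mulnC; exact: grX|nia].
Qed.

(** This is what makes x a unit in every localization indexed by a nonempty
    set. *)
Lemma pr_pow_div J : J != finset.set0 -> exists w, pr J ^+ r0.+1 = x * w.
Proof.
case/finset.set0Pn => j jJ; have [h _ e] := f_pow_div 1 j.
rewrite (prodD1 _ jJ) exprMn -addn1 e.
by exists (pr (J :\ j)%SET ^+ (r0 + 1) * h); ring.
Qed.

Lemma torsion_of_f_torsion s N : (forall j, f j ^+ N * s = 0) ->
  exists p, x ^+ p * s = 0.
Proof.
move=> fs; have [p [g e]] := x_pow_comb N; exists p.
by rewrite e big_distrl big1 //= => j _; rewrite -mulrA fs mulr0.
Qed.

(** Finitely many denominators are brought to one exponent, large enough for
    the cocycle condition to hold in S itself and not only in the
    localizations. *)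
Lemma common_numerators i n (c : cech_cochain f) :
  cech_homogeneous gr deg i n c -> cech_cocycle i c ->
  exists N (s : {set 'I_r} -> S),
    (forall J, #|J| = i -> c J = loc_frac (pr J) (s J) N /\
      gr_int gr (n + (N * dg J)%N%:Z) (s J)) /\
    (forall K, #|K| = i.+1 -> num_d f N s K = 0).
Proof.
move=> c_hom c_coc.
have grp J k := gr_prod J k (fun j => (f_deg j).2).
have /choice[h hP] : forall J : {set 'I_r}, exists sk : S * nat, #|J| = i ->
    gr_int gr (n + (sk.2 * dg J)%N%:Z) sk.1 /\ c J = loc_frac (pr J) sk.1 sk.2.
  move=> J; have [Ji|/eqP Ji] := eqVneq #|J| i; last by exists (0, 0%N).
  by have [s [k []]] := c_hom J Ji; exists (s, k).
have [N1 hN] : exists N1, forall J, ((h J).2 <= N1)%N.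
  by exists (\max_(J : {set 'I_r}) (h J).2)%N => J; exact: (leq_bigmax J).
pose s1 J := (h J).1 * pr J ^+ (N1 - (h J).2).
have c1 J : #|J| = i -> c J = loc_frac (pr J) (s1 J) N1.
  by move=> /hP[_ ->]; rewrite /s1 -{2}(subnKC (hN J)) -loc_frac_expand.
have /choice[l lP] : forall K : {set 'I_r}, exists l, #|K| = i.+1 ->
    pr K ^+ l * num_d f N1 s1 K = 0.
  move=> K; have [Ki|/eqP Ki] := eqVneq #|K| i.+1; last by exists 0%N.
  have := c_coc K Ki; rewrite (@cech_dE _ _ _ c s1 N1); last first.
    by move=> j jK; apply: c1; apply/eqP; rewrite -eqSS -Ki (cardsD1 j K) jK.
  by move=> /loc_frac_eq0[k e]; exists k.
have [M lM] : exists M, forall K, (l K <= M)%N.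
  by exists (\max_(K : {set 'I_r}) l K)%N => K; exact: (leq_bigmax K).
exists (N1 + M)%N, (fun J => s1 J * pr J ^+ M); split=> [J Ji|K Ki].
  split; first by rewrite c1 // (loc_frac_expand _ _ N1 M).
  have /(gr_intM)/(_ (grp J (N1 - (h J).2)%N)) := (hP J Ji).1.
  move=> /(gr_intM)/(_ (grp J M)); rewrite -!addrA -!PoszD -!mulnDl.
  by rewrite addnA subnKC.
have e : pr K ^+ M * num_d f N1 s1 K = 0.
  by rewrite -(subnK (lM K)) exprD -mulrA lP // mulr0.
rewrite -[RHS]e /num_d big_distrr; apply: eq_bigr => j jK /=.
rewrite (prodD1 _ jK) exprD exprMn.
move: (s1 _) (\prod_(l in _) _) ((-1) ^+ _) => a b e'; ring.
Qed.

(** By [num_homotopy], x^p c is the coboundary of an explicit cochain. In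
    cohomological degree at least 2 that cochain can be divided by x^p, since
    x is a unit wherever it lives. In degree 1 it is an element u of S, whose
    component of degree n + p is divisible by x^p if n is at least r0. In
    degree 0 a cocycle is an element killed by a power of each f j, hence of
    x. *)
Lemma cech_nonzero_cases i n (c : cech_cochain f) :
  cech_homogeneous gr deg i n c -> cech_cocycle i c -> ~ cech_coboundary i c ->
  (i = 0%N /\ exists k s, [/\ n = k%:Z, gr k s, s != 0
                            & exists p, x ^+ p * s = 0]) \/
  (i = 1%N /\ n < r0%:Z).
Proof.
move=> c_hom c_coc c_ncob.
have [N [s [cs s_coc]]] := common_numerators c_hom c_coc.
have [p [g xp]] := x_pow_comb N.
have hs := num_homotopy g s_coc; rewrite -xp in hs.
case: i => [|[|i]] in c_hom c_coc c_ncob cs s_coc hs *.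
- left; split=> //.
  have [c0 s0] := cs _ (finset.cards0 _).
  rewrite big_set0 muln0 addr0 in s0.
  have xs : x ^+ p * s finset.set0 = 0.
    by rewrite -hs ?finset.cards0 // /num_d big_set0.
  have nz : s finset.set0 != 0.
    apply: contra_notN c_ncob => /eqP z; exists c => J /eqP.
    rewrite cards_eq0 => /eqP ->.
    by rewrite c0 z loc_frac0 cech_d_set0.
  case: n => [n|n] /= in c_hom cs s0 *.
    by exists n, (s finset.set0); split=> //; exists p.
  by rewrite s0 eqxx in nz.
- right; split=> //; rewrite ltNge; apply/negP => rn.
  case: n => [n|//] in c_hom cs rn.
  rewrite lez_nat in rn.
  set u := num_h g s finset.set0.
  have xu j : x ^+ p * s [set j]%SET = f j ^+ N * u.
    rewrite -hs ?cards1 // /num_d big_set1 finset.setDv.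
    by rewrite /cech_sign big_set1 ltnn expr0 mul1r.
  have [v nv e] := x_surj_pow rn (cmp_gr G (n + p) u).
  have xv j : x ^+ p * s [set j]%SET = x ^+ p * (f j ^+ N * v).
    rewrite xu mulrCA -e.
    have [_ sj] := cs [set j]%SET (cards1 _); rewrite big_set1 /= in sj.
    have [_ fj] := f_deg j.
    rewrite -(cmpMl _ _ (grX N fj)) -xu cmp_id //.
    rewrite (_ : (_ + _)%N = (1 * p + (n + N * deg j))%N); last by lia.
    by apply: grM => //; exact: grX.
  apply: c_ncob; exists (cochain_of f (fun=> v) 0) => J J1.
  have [j Jj] : exists j, J = [set j]%SET by apply/cards1P; rewrite J1.
  rewrite cech_d_cochain_of (cs J J1).1.
  have -> : num_d f 0 (fun=> v) J = v.
    by rewrite Jj /num_d big_set1 /cech_sign big_set1 ltnn expr0 !mul1r.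
  have [w xw] : exists w, pr J ^+ r0.+1 = x * w.
    by apply: pr_pow_div; rewrite -card_gt0 J1.
  apply: (loc_frac_cancel (y := x ^+ p) (q := (r0.+1 * p)%N) (w := w ^+ p)).
    by rewrite exprM xw exprMn.
  by rewrite Jj big_set1 expr0 mul1r xv.
- case: c_ncob.
  have /choice[w wP] : forall J : {set 'I_r}, exists w,
      J != finset.set0 -> pr J ^+ r0.+1 = x * w.
    move=> J; have [->|/pr_pow_div[w ?]] := eqVneq J finset.set0; by [exists 0|exists w].
  (* On S_(f_J), J nonempty, w J / f_J^(r0 + 1) is the inverse of x. *)
  pose M := (r0.+1 * p)%N.
  exists (cochain_of f (fun J => num_h g s J * w J ^+ p) (N + M)) => J Ji.
  rewrite cech_d_cochain_of (cs J Ji).1.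
  apply: (loc_frac_cancel (y := x ^+ p) (q := M) (w := w J ^+ p)).
    by rewrite exprM wP ?exprMn // -card_gt0 Ji.
  rewrite exprD; transitivity (pr J ^+ N * pr J ^+ M * (x ^+ p * s J)); first by ring.
  rewrite -hs // [RHS]mulrCA -mulrA; congr (_ * _).
  rewrite /num_d !big_distrr; apply: eq_bigr => j jJ /=.
  have /wP wJ : (J :\ j)%SET != finset.set0.
    by move: Ji; rewrite -card_gt0 (cardsD1 j J) jJ add1n => -[->].
  by rewrite (prodD1 _ jJ) exprMn exprD [pr (J :\ j)%SET ^+ M]exprM wJ exprMn; ring.
Qed.

(** In degree 0 there are no nonzero coboundaries, and s is a cocycle because
    it vanishes in the localization at each f j. *)
Lemma torsion_neq0 n s p : gr n s -> s != 0 -> x ^+ p * s = 0 ->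
  local_cohomology_neq0 gr 0 n%:Z.
Proof.
move=> ns s0 xs; exists r, f, deg; split=> //.
exists (cochain_of f (fun=> s) 0); split.
- move=> J /eqP; rewrite cards_eq0 => /eqP ->; exists s, 0%N.
  by split=> //; rewrite mul0n addr0.
- move=> K /eqP/cards1P[j ->]; rewrite cech_d_cochain_of.
  apply/loc_frac_eq0; have [h _ e] := f_pow_div p j.
  exists (r0 + p)%N; rewrite /num_d !big_set1 /cech_sign big_set1 ltnn.
  by rewrite !expr0 !mul1r e mulrAC xs mul0r.
- move=> [b /(_ _ (finset.cards0 _))].
  rewrite cech_d_set0 => /loc_frac_eq0[l].
  by rewrite big_set0 expr1n mul1r => /eqP; rewrite (negPf s0).
Qed.

(** The cocycle is s / x, read in each localization at f j through f j ^+ (r0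
    + 1) = x * h j. If it is the coboundary of u, then s - x u is killed by a
    power of x, and so is its component of degree n. *)
Lemma generator_neq0 n s : gr n s ->
  (forall t, s <> x * t) ->
  (exists2 t, gr n t /\ t != 0 & exists p, x ^+ p * t = 0) \/
  local_cohomology_neq0 gr 1 (n%:Z - 1).
Proof.
move=> ns s_gen.
have grp J k := gr_prod J k (fun j => (f_deg j).2).
have /choice[h hP] j : exists h, gr ((r0 + 1) * deg j - 1)%N h /\
    f j ^+ (r0 + 1) = x * h.
  by have [h ? ?] := f_pow_div 1 j; exists h.
pose w (J : {set 'I_r}) := \sum_(j in J) h j.
have w1 j : w [set j]%SET = h j by rewrite /w big_set1.
pose c := cochain_of f (fun J => s * w J) (r0 + 1).
have c_hom : cech_homogeneous gr deg 1 (n%:Z - 1) c.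
  move=> J /eqP/cards1P[j ->]; exists (s * w [set j]%SET), (r0 + 1)%N; split=> //.
  have [hj _] := hP j; have [d0 _] := f_deg j.
  rewrite w1 big_set1 (_ : _ + _ = (n + ((r0 + 1) * deg j - 1))%N%:Z); last by nia.
  exact: grM ns hj.
have c_coc : cech_cocycle 1 c.
  move=> K /eqP/cards2P[a [b [ab Kab]]]; rewrite cech_d_cochain_of.
  have aK : a \in K by rewrite Kab !inE eqxx.
  have xw : pr K ^+ (r0 + 1) = f a ^+ (r0 + 1) * x * h b.
    by rewrite Kab big_setU1 ?inE //= big_set1 exprMn (hP b).2 mulrA.
  apply/loc_frac_eq0; exists (r0 + 1)%N; rewrite xw.
  suff : x * num_d f (r0 + 1) (fun J => s * w J) K = 0.
    by rewrite -2!mulrA => e; rewrite [x * _]mulrCA e !mulr0.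
  have Ka : (K :\ a)%SET = [set b]%SET.
    by rewrite Kab finset.setU1K // inE.
  have Kb : (K :\ b)%SET = [set a]%SET.
    by rewrite Kab finset.setUC finset.setU1K // inE eq_sym.
  rewrite /num_d {1}Kab big_setU1 ?inE //= big_set1 Ka Kb !w1 (hP a).2 (hP b).2.
  rewrite /cech_sign Kab !big_setU1 ?inE //= !big_set1 !ltnn.
  by case: ltngtP ab => [_ _|_ _|/val_inj ->]; rewrite ?eqxx // ?(expr0, expr1); ring.
have [[b cb]|c_ncob] := pselect (cech_coboundary 1 c); last first.
  by right; exists r, f, deg; split=> //; exists c.
(* At the empty set the localization is at an empty product, so that the
   denominator of b may be dropped. *)
left; set u := (repr (b finset.set0) : loc_pre S).1.
set k := (repr (b finset.set0) : loc_pre S).2.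
have bu : b finset.set0 = loc_frac _ u 0.
  rewrite (loc_frac_repr (b _)) -/u -/k; apply/loc_fracP; exists 0%N.
  by rewrite !big_set0 !expr1n.
have eq_j j : exists l, f j ^+ l * (s - x * u) = 0.
  have := cb [set j]%SET (cards1 _); rewrite (@cech_dE _ _ _ b (fun=> u) 0); last first.
    by move=> i; rewrite inE => /eqP ->; rewrite finset.setDv bu.
  have -> : num_d f 0 (fun=> u) [set j]%SET = u.
    by rewrite /num_d big_set1 /cech_sign big_set1 ltnn !expr0 !mul1r.
  rewrite /c /cochain_of w1 => /loc_fracP[l]; rewrite big_set1 expr0 mul1r => e.
  exists (l + (r0 + 1))%N; rewrite mulrBr exprD.
  have -> : f j ^+ l * f j ^+ (r0 + 1) * s = x * (f j ^+ l * (s * h j)).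
    by rewrite (hP j).2; ring.
  by rewrite e; ring.
have /choice[l lP] := eq_j.
have [L lL] : exists L, forall j, (l j <= L)%N.
  by exists (\max_j l j)%N => j; exact: (leq_bigmax j).
have [p xp] : exists p, x ^+ p * (s - x * u) = 0.
  apply: (@torsion_of_f_torsion _ L) => j.
  by rewrite -(subnK (lL j)) exprD -mulrA lP mulr0.
exists (cmp n (s - x * u)); last first.
  by exists p; rewrite -(cmpMl _ _ (grX p x_deg)) xp cmp0.
split; first exact: cmp_gr.
rewrite cmpB (cmp_id G ns) subr_eq0; apply/eqP.
case: n {ns c_hom c_coc c cb} => [|n]; last by rewrite (cmpMl n _ x_deg).
by rewrite (cmpMl_lt _ x_deg) // -(mulr0 x).
Qed.

End System.

Lemma reg_le_torsion B :
  (forall n s p, gr n s -> s != 0 -> x ^+ p * s = 0 -> (n%:Z%:E <= B)%E) ->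
  (r0%:Z%:E <= B)%E -> (reg gr <= B)%E.
Proof.
move=> torsB r0B; apply: reg_le => i n [r [f [deg [fd fg [c [hc zc bc]]]]]].
have [[-> [k [s [-> ks s0 [p xs]]]]]|[-> nr]] := cech_nonzero_cases fd fg hc zc bc.
  by rewrite addr0; exact: torsB ks s0 xs.
by apply: le_trans r0B; rewrite lee_fin lezD1.
Qed.

Definition has_homogeneous_generators :=
  exists r (f : 'I_r -> S) (deg : 'I_r -> nat),
    (forall j, (0 < deg j)%N /\ gr (deg j) (f j)) /\
    ideal_gen (range f) = irrelevant_ideal gr.

Lemma torsion_le_reg n s p : has_homogeneous_generators ->
  gr n s -> s != 0 -> x ^+ p * s = 0 -> (n%:Z%:E <= reg gr)%E.
Proof.
move=> [r [f [deg [fd fg]]]] ns s0 xs; rewrite -[n%:Z]addr0.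
exact/reg_ub/(torsion_neq0 fd fg ns s0 xs).
Qed.

Lemma generator_le_reg n s : has_homogeneous_generators ->
  gr n s -> (forall t, s <> x * t) -> (n%:Z%:E <= reg gr)%E.
Proof.
move=> sys ns s_gen; have [r [f [deg [fd fg]]]] := sys.
have [[t [nt t0] [p xt]]|/reg_ub] := generator_neq0 fd fg ns s_gen.
  exact: torsion_le_reg sys nt t0 xt.
by rewrite subrK.
Qed.

End LocalCohomology.
End GradedRings.

(** * Linear parameters of graded algebras of dimension one *)

Lemma poly_sumE (R : nzRingType) (g : {poly R}) n :
  (size g <= n)%N -> g = \sum_(i < n) g`_i *: 'X^i.
Proof.
move=> gn; rewrite -(poly_def n (fun i => g`_i)); apply/polyP => i.
by rewrite coef_poly; case: ltnP => // ni; rewrite nth_default // (leq_trans gn).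
Qed.

Section LinearParameter.
Variables (k : fieldType) (S : comNzRingType) (gr : nat -> set S).
Variables (G : grading gr) (io : {rmorphism k -> S}).
Local Notation cmp := (cmp G).
Local Notation grM := (grM G).
Implicit Types (I J P T W : set S) (s t x y z : S) (xs ys : seq S).

Definition homog I := forall n s, I s -> I (cmp n s).

(** The largest homogeneous ideal contained in P. *)
Definition homog_core P : set S := [set s | forall n, P (cmp n s)].

Lemma cmp_mem_ideal I a s n : is_ideal I ->
  (forall i, (i <= n)%N -> I (cmp i a * cmp (n - i) s)) -> I (cmp n (a * s)).
Proof.
move=> idI Ias; have [N ->] := cmp_total G a.
rewrite big_distrl cmp_sum; apply: (ideal_sum idI) => i _ /=.
have [ni|ni] := leqP i n.
  by rewrite -{1}(subnKC ni) (cmpMl _ _ _ (cmp_gr G i a)); exact: Ias.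
by rewrite (cmpMl_lt _ _ (cmp_gr G i a)) //; exact: ideal0.
Qed.

Lemma homog_core_sub P : is_ideal P -> homog_core P `<=` P.
Proof.
by move=> idP s Ps; have [N ->] := cmp_total G s; exact: ideal_sum.
Qed.

Lemma sub_homog_core I P : homog I -> I `<=` P -> I `<=` homog_core P.
Proof. by move=> hI IP s Is n; exact/IP/hI. Qed.

Lemma homog_core_homog P : is_ideal P -> homog (homog_core P).
Proof.
move=> idP n s Ps i; rewrite cmp_cmp; case: eqP => _; first exact: Ps.
exact: ideal0.
Qed.

Lemma homog_core_ideal P : is_ideal P -> is_ideal (homog_core P).
Proof.
move=> idP; split=> [n|s t Ps Pt n|a s Ps n].
- by rewrite cmp0; exact: ideal0.
- by rewrite cmpD; exact: idealD.
- by apply: cmp_mem_ideal => // i _; exact: idealM.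
Qed.

(** The components of smallest degree outside P of two elements multiply,
    modulo P, to a component of their product. *)
Lemma homog_core_prime P : is_prime P -> is_prime (homog_core P).
Proof.
case=> idP PT prP; split; first exact: homog_core_ideal.
  move=> PT'; apply: PT; apply: ideal_eqT => //; apply: homog_core_sub => //.
  by rewrite PT'.
move=> x y Pxy; apply: contrapT => /not_orP[Px Py].
have ex z : ~ homog_core P z -> exists i, `[< ~ P (cmp i z) >].
  by move=> /existsNP[i Pi]; exists i; exact/asboolP.
case: (ex_minnP (ex x Px)) => i /asboolP Pi imin.
case: (ex_minnP (ex y Py)) => j /asboolP Pj jmin.
have lt_i a : (a < i)%N -> P (cmp a x).
  by move=> ai; apply: contrapT => /asboolP/imin; rewrite leqNgt ai.
have lt_j a : (a < j)%N -> P (cmp a y).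
  by move=> aj; apply: contrapT => /asboolP/jmin; rewrite leqNgt aj.
have /prP[] // : P (cmp i x * cmp j y).
pose x' := x - cmp i x.
have -> : cmp i x * cmp j y = cmp (i + j) (x * y) - cmp (i + j) (x' * y).
  by rewrite -cmpB -mulrBl /x' opprB subrKC (cmpMl _ _ _ (cmp_gr G i x)).
apply: (idealB idP); first exact: Pxy.
apply: cmp_mem_ideal => // a aij; rewrite /x' cmpB cmp_cmp.
case: (ltngtP a i) => ai.
- by apply: ideal_mulr => //; rewrite subr0; exact: lt_i.
- by apply: idealM => //; apply: lt_j; lia.
- by rewrite ai subrr mul0r; exact: ideal0.
Qed.

Lemma homog_avoid_prime I T : is_ideal I -> homog I -> T 1 ->
  (forall x y, T x -> T y -> T (x * y)) -> I `&` T = set0 ->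
  exists P, [/\ is_prime P, homog P, I `<=` P & P `&` T = set0].
Proof.
move=> idI hI T1 TM IT.
have [P [prP IP PT]] := ideal_avoid_prime idI T1 TM IT.
have [idP _ _] := prP.
exists (homog_core P); split.
- exact: homog_core_prime.
- exact: homog_core_homog.
- exact: sub_homog_core.
- apply/seteqP; split=> // s [/(homog_core_sub idP) Ps Ts].
  by have : (P `&` T) s by []; rewrite PT.
Qed.

Lemma homog_adjoin I d y : is_ideal I -> homog I -> gr d y -> homog (adjoin I y).
Proof.
move=> idI hI dy n s [z /(hI n)]; rewrite cmpB => Iz.
have [dn|nd] := leqP d n.
  by exists (cmp (n - d) z); rewrite -(cmpMl G _ _ dy) subnKC.
by exists 0; move: Iz; rewrite (cmpMl_lt _ _ dy) // mulr0.
Qed.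

Lemma homog_adjoins I xs : is_ideal I -> homog I -> [set` xs] `<=` gr 1%N ->
  homog (adjoins I xs).
Proof.
move=> idI hI; elim: xs => //= y xs IH xs1; apply: (@homog_adjoin _ 1%N).
- exact: adjoins_ideal.
- by apply: IH => z zxs; apply: xs1; rewrite /= inE zxs orbT.
- by apply: xs1; rewrite /= mem_head.
Qed.

Lemma homog0 : homog [set 0].
Proof. by move=> n s ->; exact: cmp0. Qed.

(** An ideal satisfying this contains a power of S_+. *)
Definition high_degrees I := exists N, forall n s, (N <= n)%N -> gr n s -> I s.

Lemma high_degreesS I J : I `<=` J -> high_degrees I -> high_degrees J.
Proof. by move=> IJ [N IN]; exists N => n s nN /IN Is; exact/IJ/Is. Qed.

(** Dividing by y one degree at a time; homogeneity of I lets the quotient be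
    chosen homogeneous. *)
Lemma adjoin_descent I y N : is_ideal I -> homog I -> gr 1%N y ->
  (forall n s, (N <= n)%N -> gr n s -> adjoin I y s) ->
  forall q n s, (N <= n)%N -> gr (n + q)%N s ->
    exists2 z, gr n z & I (s - y ^+ q * z).
Proof.
move=> idI hI y1 IN; elim=> [|q IH] n s nN.
  rewrite addn0 => ns; exists s => //.
  by rewrite expr0 mul1r subrr; exact: ideal0.
move=> nqs; have [|z0 Iz0] := IN _ _ _ nqs; first exact: leq_trans (leq_addr _ _).
have := hI (n + q.+1)%N _ Iz0.
rewrite cmpB (cmp_id G nqs) addnS -add1n (cmpMl G _ _ y1) => {}Iz0.
have [z nz Iz] := IH n _ nN (cmp_gr G _ z0).
exists z => //; rewrite (_ : _ - _ =
  s - y * cmp (n + q) z0 + y * (cmp (n + q) z0 - y ^+ q * z)).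
  by apply: (idealD idI) => //; exact: idealM.
by rewrite exprS; ring.
Qed.

Lemma high_degrees_adjoin_pow I y e : is_ideal I -> homog I -> gr 1%N y ->
  I (y ^+ e) -> high_degrees (adjoin I y) -> high_degrees I.
Proof.
move=> idI hI y1 Iye [N IN]; exists (N + e)%N => n s nNe ns.
have en : (e <= n)%N by exact: leq_trans (leq_addl _ _) nNe.
have [||z _] := adjoin_descent idI hI y1 IN (q := e) (n := (n - e)%N) (s := s).
- by rewrite leq_subRL // addnC.
- by rewrite subnK.
by apply: ideal_subr => //; exact: ideal_mulr.
Qed.

(** The generators are dropped one by one, as a power of each lies in I. *)
Lemma high_degrees_adjoins_pow I xs : is_ideal I -> homog I -> [set` xs] `<=` gr 1%N ->
  [set` xs] `<=` radical I -> high_degrees (adjoins I xs) -> high_degrees I.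
Proof.
move=> idI hI; elim: xs => //= y xs IH xs1 xsI co.
have xs1' : [set` xs] `<=` gr 1%N.
  by move=> z zxs; apply: xs1; rewrite /= inE zxs orbT.
apply: IH => //.
  by move=> z zxs; apply: xsI; rewrite /= inE zxs orbT.
have [e Iye] : radical I y by apply: xsI; rewrite /= mem_head.
apply: (@high_degrees_adjoin_pow _ y e) => //.
- exact: adjoins_ideal.
- exact: homog_adjoins.
- by apply: xs1; rewrite /= mem_head.
- exact: sub_adjoins.
Qed.

Hypothesis gr0_io : forall s, gr 0%N s -> exists c, s = io c.

Definition irrelevant : set S := [set s | cmp 0 s = 0].

Lemma cmp0M s t : cmp 0 (s * t) = cmp 0 s * cmp 0 t.
Proof.
have [N e] := cmp_total G s.
rewrite [in LHS]e [in X in _ = X * _]e big_distrl !cmp_sum big_distrl /=.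
apply: eq_bigr => i _; rewrite cmp_cmp.
case: eqP => [<-|]; first by rewrite -(cmpMl _ _ _ (cmp_gr G 0 s)).
move=> i0; rewrite mul0r (cmpMl_lt _ _ (cmp_gr G i s)) // lt0n.
by apply/eqP => i0'; apply: i0.
Qed.

(** The quotient is the field k, the component of degree 0. *)
Lemma irrelevant_prime : is_prime irrelevant.
Proof.
split.
- rewrite /irrelevant; split=> [|s t|a s] /=; first exact: cmp0.
  + by rewrite cmpD => -> ->; rewrite addr0.
  + by rewrite cmp0M => ->; rewrite mulr0.
- move=> iT; have : irrelevant 1 by rewrite iT.
  by rewrite /irrelevant /= (cmp_id G (gr1 G)) => /eqP; rewrite oner_eq0.
- move=> s t; rewrite /irrelevant /= cmp0M.
  have [c ->] := gr0_io (cmp_gr G 0 s); have [d ->] := gr0_io (cmp_gr G 0 t).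
  rewrite -rmorphM => /eqP; rewrite fmorph_eq0 mulf_eq0 => /orP[] /eqP ->.
    by left; rewrite rmorph0.
  by right; rewrite rmorph0.
Qed.

Lemma homog_prime_sub P : is_prime P -> homog P -> P `<=` irrelevant.
Proof.
move=> [idP PT _] hP s /(hP 0%N); rewrite /irrelevant /=.
have [c ->] := gr0_io (cmp_gr G 0 s) => Pc.
have [->|c0] := eqVneq c 0; first exact: rmorph0.
case: (ideal_proper idP PT); rewrite -(rmorph1 io) -(mulVf c0) rmorphM.
exact: idealM.
Qed.

Section Forms.
Variables (x1 x2 : S).
Hypotheses (x1_deg : gr 1%N x1) (x2_deg : gr 1%N x2).
Implicit Types (g h : {poly k}).

(** The homogenization of g in degree e, evaluated at (x1, x2). *)
Definition form e g : S := \sum_(i < e.+1) io g`_i * (x1 ^+ i * x2 ^+ (e - i)).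

Lemma formD e g h : form e (g + h) = form e g + form e h.
Proof.
rewrite -big_split /=; apply: eq_bigr => i _.
by rewrite coefD rmorphD mulrDl.
Qed.

Lemma form0 e : form e 0 = 0.
Proof. by rewrite /form big1 // => i _; rewrite coef0 rmorph0 mul0r. Qed.

Lemma formZX e c i : (i <= e)%N -> form e (c *: 'X^i) = io c * (x1 ^+ i * x2 ^+ (e - i)).
Proof.
move=> ie; rewrite /form (bigD1 (inord i)) //= inordK // big1 ?addr0.
  by rewrite coefZ coefXn eqxx mulr1.
move=> j ji; rewrite coefZ coefXn; case: eqP => [ji'|_].
  by case/eqP: ji; apply: val_inj; rewrite /= inordK.
by rewrite mulr0 rmorph0 mul0r.
Qed.

Lemma formM e f g h : (size g <= e.+1)%N -> (size h <= f.+1)%N ->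
  form e g * form f h = form (e + f) (g * h).
Proof.
move=> ge hf; rewrite [in RHS](poly_sumE ge) [in RHS](poly_sumE hf).
rewrite [in LHS]/form !big_distrl /= (big_morph _ (formD (e + f)) (form0 _)).
apply: eq_bigr => i _.
rewrite !big_distrr /= (big_morph _ (formD (e + f)) (form0 _)).
apply: eq_bigr => j _.
have [ie jf] := (leq_ord i, leq_ord j).
rewrite -scalerAl -scalerAr scalerA -exprD formZX ?leq_add //.
by rewrite (_ : (e + f - _)%N = (e - i + (f - j))%N) ?rmorphM ?exprD; [ring|lia].
Qed.

Lemma monomial_gr e i : (i <= e)%N -> gr e (x1 ^+ i * x2 ^+ (e - i)).
Proof.
move=> ie; have := grM (grX G i x1_deg) (grX G (e - i) x2_deg).
by rewrite !mul1n subnKC.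
Qed.

Definition forms : set S :=
  [set s | exists e g, [/\ g != 0, (size g <= e.+1)%N & s = form e g]].

Lemma forms1 : forms 1.
Proof.
exists 0%N, 1; rewrite oner_neq0 size_poly1; split=> //.
by rewrite /form big_ord1 coef1 rmorph1 !mul1r.
Qed.

Lemma formsM s t : forms s -> forms t -> forms (s * t).
Proof.
move=> [e [g [g0 ge ->]]] [f [h [h0 hf ->]]].
exists (e + f)%N, (g * h); rewrite mulf_neq0 //; split=> //; last exact: formM.
by rewrite size_mul // -ltnS; have := leq_add ge hf; rewrite addSn addnS; case: (_ + _)%N.
Qed.

Lemma forms_x1 : forms x1.
Proof.
exists 1%N, 'X; rewrite polyX_eq0 size_polyX; split=> //.
rewrite -['X]scale1r -['X]expr1 formZX //.
by rewrite rmorph1 mul1r subnn mulr1.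
Qed.

Hypothesis k_inf : infinite_set [set: k].

Lemma nonroot g : g != 0 -> exists c, g.[c] != 0.
Proof.
move=> g0; apply: contrapT => /forallNP no.
have [s us sg] : exists2 s : seq k, uniq s & size s = size g.
  elim: (size g) => [|n [s us sn]]; first by exists [::].
  have [c cs] : exists c, c \notin s.
    apply: contrapT => /forallNP all_s; apply: k_inf.
    apply: (sub_finite_set _ (finite_seq s)) => c _ /=.
    by apply/negPn/negP/all_s.
  by exists (c :: s); rewrite /= ?cs ?sn.
have := max_poly_roots g0 (rs := s); rewrite us sg ltnn => /(_ _ isT) F.
suff : false by []; apply: F; apply/allP => c _; apply/rootP/eqP.
by apply/negPn/negP/no.
Qed.

(** Modulo x1 - c x2 the form becomes g(c) x2^e; an infinite field has a c
    with g(c) nonzero. *)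
Lemma relation_pow e g : g != 0 -> (size g <= e.+1)%N -> form e g = 0 ->
  exists c, forall I, is_ideal I -> I (x1 - io c * x2) -> I (x2 ^+ e).
Proof.
move=> g0 ge fg; have [c gc] := nonroot g0; exists c => I idI Iy.
suff H : I (io g.[c] * x2 ^+ e).
  rewrite -[x2 ^+ e]mul1r -(rmorph1 io) -(mulVf gc) rmorphM -mulrA.
  exact: idealM.
rewrite (horner_coef_wide _ ge) rmorph_sum big_distrl /=.
apply: (ideal_subr idI (y := form e g)); first by rewrite fg; exact: ideal0.
rewrite /form -sumrB; apply: (ideal_sum idI) => i _.
rewrite rmorphM rmorphXn.
rewrite -[in X in _ * x2 ^+ X](subnKC (leq_ord i)) exprD.
rewrite (_ : _ - _ = - (io g`_i * x2 ^+ (e - i)) * (x1 ^+ i - (io c * x2) ^+ i)).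
  by apply: (idealM idI); rewrite subrXX; exact: ideal_mulr.
by rewrite exprMn; ring.
Qed.

Hypothesis gr_fg : forall n, exists ys, forall s, gr n s ->
  exists c : nat -> k, s = \sum_(i < size ys) io (c i) * ys`_i.

(** Otherwise each monomial of degree N + t in x1, x2 is, modulo P, x1^t times
    an element of degree N, so that these N + t + 1 monomials lie in a space
    of dimension at most t, where t is the number of generators in degree N. A
    linear relation between them is a nonzero form in P. *)
Lemma forms_not_high_degrees P : is_prime P -> homog P -> P `&` forms = set0 ->
  ~ high_degrees (adjoin P x1).
Proof.
move=> [idP _ _] hP Pforms [N PN].
have desc := adjoin_descent idP hP x1_deg PN.
have [ys ysP] := gr_fg N; set t := size ys; set e := (N + t)%N.
have /choice[c cP] (i : 'I_e.+1) : exists c : nat -> k,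
    P (x1 ^+ i * x2 ^+ (e - i) - x1 ^+ t * \sum_(l < t) io (c l) * ys`_l).
  have [|z /ysP[c ->] Pz] := desc t N (x1 ^+ i * x2 ^+ (e - i)) (leqnn _).
    exact/monomial_gr/leq_ord.
  by exists c.
pose C := \matrix_(i < e.+1, l < t) c i l.
have [v vC v0] : exists2 v : 'rV[k]_e.+1, v *m C = 0 & v != 0.
  apply: contrapT => no.
  have : row_free C.
    apply: inj_row_free => v vC; apply/eqP/negPn/negP => v0.
    by apply: no; exists v.
  rewrite /row_free => /eqP rC; have := rank_leq_col C.
  by rewrite rC /e; lia.
have gv i : (rVpoly v)`_i = if insub i is Some j then v 0 j else 0.
  by rewrite coef_rVpoly.
have : (P `&` forms) (form e (rVpoly v)); last by rewrite Pforms.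
split; last first.
  exists e, (rVpoly v); split=> //; last exact: size_poly.
  by apply: contraNneq v0 => z; rewrite -[v]rVpolyK z linear0.
apply: (ideal_subr idP (y := x1 ^+ t * \sum_(i < e.+1) io (v 0 i) *
    \sum_(l < t) io (c i l) * ys`_l)).
  rewrite (_ : \sum_(i < _) _ = 0) ?mulr0; first exact: ideal0.
  transitivity (\sum_(l < t) io ((v *m C) 0 l) * ys`_l).
    under eq_bigr do rewrite big_distrr /=.
    rewrite exchange_big; apply: eq_bigr => l _ /=.
    rewrite mxE rmorph_sum big_distrl; apply: eq_bigr => i _ /=.
    by rewrite mxE rmorphM mulrA.
  by rewrite vC big1 // => l _; rewrite mxE rmorph0 mul0r.
rewrite big_distrr -sumrB; apply: (ideal_sum idP) => i _ /=.
by rewrite coef_rVpoly_ord [x1 ^+ t * _]mulrCA -mulrBr; apply: (idealM idP); exact: cP.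
Qed.

End Forms.

Hypothesis k_inf : infinite_set [set: k].
Hypothesis gr_fg : forall n, exists ys, forall s, gr n s ->
  exists c : nat -> k, s = \sum_(i < size ys) io (c i) * ys`_i.
Hypothesis dim_le1 : forall Q : nat -> set S, ~ prime_chain 2 Q.

(** Without a relation there would be a chain of homogeneous primes P0, P1,
    S_+: P0 avoids the forms in x1 and x2, while P1 contains P0 and x1 but not
    some linear generator y, none of whose powers lies in P0 + (x1). *)
Lemma forms_relation x1 x2 xs : x1 \in xs -> [set` xs] `<=` gr 1%N ->
  gr 1%N x2 -> high_degrees (adjoins [set 0] xs) -> forms x1 x2 0.
Proof.
move=> x1xs xs1 x2_deg co; apply: contrapT => f0.
have x1_deg : gr 1%N x1 by exact: xs1.
have [P0 [prP0 hP0 _ P0f]] : exists P, [/\ is_prime P, homog P,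
    [set 0] `<=` P & P `&` forms x1 x2 = set0].
  apply: homog_avoid_prime; [exact: zero_ideal|exact: homog0|exact: forms1| |].
    exact: formsM.
  by apply/seteqP; split=> // s [->].
have [idP0 _ _] := prP0.
have idI := adjoin_ideal x1 idP0; have hI := homog_adjoin idP0 hP0 x1_deg.
have nco := forms_not_high_degrees x1_deg x2_deg gr_fg prP0 hP0 P0f.
have [y yxs yI] : exists2 y, y \in xs & ~ radical (adjoin P0 x1) y.
  apply: contrapT => no; apply: nco; apply: (high_degrees_adjoins_pow idI hI xs1).
    by move=> y yxs; apply: contrapT => ny; apply: no; exists y.
  apply: high_degreesS co; apply: adjoins_sub; first exact: adjoins_ideal.
    by move=> _ ->; apply: ideal0; exact: adjoins_ideal.
  by move=> y /mem_adjoins; exact.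
have [P1 [prP1 hP1 IP1 P1y]] : exists P, [/\ is_prime P, homog P,
    adjoin P0 x1 `<=` P & P `&` [set y ^+ e | e in setT] = set0].
  apply: homog_avoid_prime => //.
  - by exists 0%N; rewrite // expr0.
  - by move=> _ _ [a _ <-] [b _ <-]; exists (a + b)%N; rewrite // exprD.
  - by apply/seteqP; split=> // s [Is [e _ es]]; apply: yI; exists e; rewrite es.
(* The default value of nth supplies the last prime S_+ of the chain. *)
apply: (dim_le1 (Q := fun i => nth irrelevant [:: P0; P1] i)); split.
  by case=> [|[|[|]]] //= _; exact: irrelevant_prime.
have [idP1 _ _] := prP1.
case=> [|[|]] //= _; split.
- exact: subset_trans (@sub_adjoin _ _ _) IP1.
- move=> P10; have : (P0 `&` forms x1 x2) x1; last by rewrite P0f.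
  split; last exact: forms_x1.
  by apply/P10/IP1; rewrite -[X in adjoin _ _ X]mulr1; exact: mem_adjoin.
- exact: homog_prime_sub.
- move=> iP1; have : (P1 `&` [set y ^+ e | e in setT]) y; last by rewrite P1y.
  split; last by exists 1%N; rewrite ?expr1.
  by apply: iP1; rewrite /irrelevant /= (cmp_neq G (xs1 _ yxs)).
Qed.

(** By induction on the number of generators, two of which are replaced by one
    as long as possible. The space W of linear forms records where the element
    comes from. *)
Lemma linear_parameter W xs : W 0 -> (forall s t, W s -> W t -> W (s + t)) ->
  (forall c s, W s -> W (io c * s)) -> W `<=` gr 1%N ->
  [set` xs] `<=` W -> high_degrees (adjoins [set 0] xs) ->
  exists2 x, W x & high_degrees (adjoin [set 0] x).
Proof.
move=> W0 WD WZ W1.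
have [n] := ubnP (size xs); elim: n xs => // n IH xs.
case: xs => [|x1 [|x2 xs]] xsn xsW co.
- by exists 0 => //; apply: high_degreesS co; exact: sub_adjoin.
- by exists x1 => //; apply: xsW; rewrite /= mem_head.
have Wx1 : W x1 by apply: xsW; rewrite /= mem_head.
have Wx2 : W x2 by apply: xsW; rewrite /= !inE eqxx orbT.
have [e [g [g0 ge fg]]] : forms x1 x2 0.
  apply: (@forms_relation _ _ [:: x1, x2 & xs]) => //.
  - by rewrite mem_head.
  - exact: subset_trans W1.
  - exact: W1.
(* x1 and x2 are replaced by y: x2 is redundant up to a power. *)
have [c cP] := relation_pow k_inf g0 ge (esym fg).
pose y := x1 - io c * x2.
have Wy : W y by apply: WD => //; rewrite -mulNr -rmorphN; exact: WZ.
have yW : [set` y :: xs] `<=` W.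
  move=> z /=; rewrite inE => /predU1P[->//|zxs].
  by apply: xsW; rewrite /= !inE zxs !orbT.
apply: (IH (y :: xs)) => //.
have id0 := @zero_ideal S.
have idI := adjoins_ideal (y :: xs) id0.
have Iy : adjoins [set 0] (y :: xs) y by apply: mem_adjoins; rewrite ?mem_head.
apply: (high_degrees_adjoin_pow idI _ (W1 _ Wx2) (cP _ idI Iy)).
  by apply: homog_adjoins => //; [exact: homog0|exact: subset_trans W1].
apply: high_degreesS co; apply: adjoins_sub; first exact: adjoin_ideal.
  by move=> _ ->; apply: ideal0; exact: adjoin_ideal.
have idJ := adjoin_ideal x2 idI.
have Jx2 : adjoin (adjoins [set 0] (y :: xs)) x2 x2.
  by rewrite -[X in adjoin _ _ X]mulr1; exact: mem_adjoin.
move=> z; rewrite /= !inE => /or3P[/eqP ->|/eqP ->//|zxs].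
  rewrite -(subrK (io c * x2) x1); apply: (idealD idJ).
    by apply: sub_adjoin; exact: Iy.
  exact: (idealM idJ _ Jx2).
by apply: sub_adjoin; apply: (@mem_adjoins _ _ (y :: xs)); rewrite // inE zxs orbT.
Qed.

End LinearParameter.

(** * Graded quotients of the Rees algebra *)

Section ReesQuotients.
Variables (A : comNzRingType) (F : filtration A).
Variables (S : comNzRingType) (q : {rmorphism rees F -> S}).
Variable (Q : nat -> set A).
Hypothesis q_surj : forall s, exists p, q p = s.
Hypothesis q_ker : forall p, q p = 0 <-> forall n, Q n (val p)`_n.

Definition rees_quot_comp (n : nat) : set S := [set q p | p in rees_comp F n].
Local Notation gr := rees_quot_comp.

Definition rees_mono n a : rees F := insubd 0 (a *: 'X^n).
(** The class of a in degree n, as an element of the quotient; meaningful when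
    a lies in F n. *)
Definition symb n a : S := q (rees_mono n a).

Lemma val_rees_mono n a : F n a -> val (rees_mono n a) = a *: 'X^n.
Proof.
move=> Fa; apply: insubdK; apply/asboolP => i; rewrite coefZ coefXn.
by case: eqP => [->|_]; rewrite ?mulr1 // mulr0; exact: fil_zero.
Qed.

Lemma symbE n a p : F n a -> val p = a *: 'X^n -> q p = symb n a.
Proof. by move=> Fa pa; congr (q _); apply: val_inj; rewrite val_rees_mono. Qed.

Lemma grP n s : gr n s <-> exists2 a, F n a & s = symb n a.
Proof.
split=> [[p [c pc] <-]|[a Fa ->]].
  have Fc : F n c by have := reesP p n; rewrite pc coefZ coefXn eqxx mulr1.
  by exists c => //; exact: symbE.
by exists (rees_mono n a) => //; exists a; exact: val_rees_mono.
Qed.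

Lemma symb_gr n a : F n a -> gr n (symb n a).
Proof. by move=> Fa; apply/grP; exists a. Qed.

Lemma symbD n a b : F n a -> F n b -> symb n (a + b) = symb n a + symb n b.
Proof.
move=> Fa Fb; rewrite -rmorphD; apply/esym/symbE; first exact: filD.
by rewrite raddfD /= !val_rees_mono // scalerDl.
Qed.

Lemma symbB n a b : F n a -> F n b -> symb n (a - b) = symb n a - symb n b.
Proof.
move=> Fa Fb; rewrite -rmorphB; apply/esym/symbE; first exact: filB.
by rewrite raddfB /= !val_rees_mono // scalerBl.
Qed.

Lemma symbM i j a b : F i a -> F j b ->
  symb (i + j) (a * b) = symb i a * symb j b.
Proof.
move=> Fa Fb; rewrite -rmorphM; apply/esym/symbE; first exact: (fil_mul erefl).
by rewrite rmorphM /= !val_rees_mono // -scalerAl -scalerAr scalerA exprD.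
Qed.

Lemma symb1 : symb 0 1 = 1.
Proof.
rewrite -(rmorph1 q); apply/esym/symbE; first by rewrite fil0.
by rewrite rmorph1 expr0 scale1r.
Qed.

Lemma Q0 n : Q n 0.
Proof. by have /q_ker/(_ n) := rmorph0 q; rewrite raddf0 coef0. Qed.

Lemma symb_eq0 n a : F n a -> symb n a = 0 <-> Q n a.
Proof.
move=> Fa; split=> [/q_ker/(_ n)|Qa].
  by rewrite val_rees_mono // coefZ coefXn eqxx mulr1.
apply/q_ker => i; rewrite val_rees_mono // coefZ coefXn.
by case: eqP => [->|_]; rewrite ?mulr1 // mulr0; exact: Q0.
Qed.

Lemma symb_eq n a b : F n a -> F n b -> symb n a = symb n b <-> Q n (a - b).
Proof.
move=> Fa Fb; rewrite -(symb_eq0 (filB Fa Fb)) symbB //.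
by split=> [->|/eqP]; rewrite ?subrr // subr_eq0 => /eqP.
Qed.

Lemma symb_coef_eq p p' n : q p = q p' ->
  symb n (val p)`_n = symb n (val p')`_n.
Proof.
move=> /eqP; rewrite -subr_eq0 -rmorphB => /eqP/q_ker/(_ n).
rewrite raddfB coefB => Qpp'.
by apply/symb_eq => //; exact: reesP.
Qed.

Definition rees_lift s : rees F := sval (cid (q_surj s)).

Lemma rees_liftK s : q (rees_lift s) = s.
Proof. exact: svalP (cid (q_surj s)). Qed.

Definition rees_cmp n s : S := symb n (val (rees_lift s))`_n.

Lemma rees_cmpE p n : rees_cmp n (q p) = symb n (val p)`_n.
Proof. by apply: symb_coef_eq; exact: rees_liftK. Qed.

Lemma symb0 n : symb n 0 = 0.
Proof. by apply/symb_eq0; [exact: fil_zero|exact: Q0]. Qed.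

Lemma rees_cmp_symb n k a : F n a ->
  rees_cmp k (symb n a) = if k == n then symb n a else 0.
Proof.
move=> Fa; rewrite rees_cmpE val_rees_mono // coefZ coefXn.
by case: eqP => [->|_]; rewrite ?mulr1 // mulr0 symb0.
Qed.

Definition rees_grading : grading gr.
Proof.
apply: (@Grading _ _ rees_cmp).
- move=> n s t; rewrite -(rees_liftK s) -(rees_liftK t) -rmorphD !rees_cmpE.
  by rewrite raddfD coefD symbD //; exact: reesP.
- by move=> n s; apply: symb_gr; exact: reesP.
- by move=> n _ /grP[a Fa ->]; rewrite rees_cmp_symb // eqxx.
- by move=> n k _ /grP[a Fa ->] /negPf kn; rewrite rees_cmp_symb // kn.
- move=> s; exists (size (val (rees_lift s))).
  rewrite -{1}(rees_liftK s) -rmorph_sum; congr (q _); apply: val_inj.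
  rewrite [LHS](poly_sumE (leqnn _)) raddf_sum; apply: eq_bigr => i _.
  by rewrite /= val_rees_mono //; exact: reesP.
- by apply/grP; exists 1; rewrite ?fil0 ?symb1.
- move=> i j _ _ /grP[a Fa ->] /grP[b Fb ->].
  by rewrite -symbM //; apply/symb_gr/(fil_mul erefl).
Defined.

(** With this, a property of the classes of all elements of F n need only be
    checked on generators of F n. *)
Lemma symb_preim_ideal n (I : set S) : is_ideal I ->
  is_ideal [set a | F n a /\ I (symb n a)].
Proof.
move=> idI; split=> [|a b [Fa Ia] [Fb Ib]|a b [Fb Ib]].
- by split; [exact: fil_zero|rewrite symb0; exact: ideal0].
- by split; [exact: filD|rewrite symbD //; exact: idealD].
- split; first exact: filZ.
  have Fa : F 0%N a by rewrite fil0.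
  by rewrite -[n]add0n symbM //; exact: idealM.
Qed.

Hypothesis noethA : noetherian A.

(** Divisibility by x in the quotient means divisibility up to Q n, which
    Nakayama's lemma absorbs. *)
Lemma principal_nakayama (m : idealr A) x n : local_ring m ->
  (forall n, Q n `<=` ideal_prod [set` m] (F n)) -> F 1%N x ->
  (forall a, F n.+1 a -> exists t, symb n.+1 a = symb 1 x * t) ->
  ideal_prod (ideal_gen [set x]) (F n) = F n.+1.
Proof.
move=> locA Qm Fx div.
have idx := @ideal_prod_ideal A (ideal_gen [set x]) (F n).
have Fxb b : F n b -> F n.+1 (x * b) by exact: (fil_mul (add1n n)).
apply/seteqP; split=> [a /(ideal_prod1 _ _ (fil_ideal F n))[b Fb ->]|].
  exact: Fxb.
have [s sF] := noethA (fil_ideal F n.+1).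
apply: (nakayama locA idx sF) => a Fa; have [t e] := div a Fa.
have := cmpMl rees_grading n t (symb_gr Fx).
rewrite add1n -e (cmp_id rees_grading (symb_gr Fa)).
have /grP[b Fb ->] := cmp_gr rees_grading n t.
rewrite -symbM // add1n => /(symb_eq Fa (Fxb b Fb))/Qm mQ.
exists (a - x * b) => //; rewrite opprB addrC subrK.
by apply/(ideal_prod1 _ _ (fil_ideal F n)); exists b.
Qed.

Section PrincipalReduction.
Variables (x : A) (r : nat).
Hypothesis Fx : F 1%N x.
Hypothesis x_red : forall n, (r <= n)%N -> forall a, F n.+1 a ->
  exists2 b, F n b & a = x * b.

Lemma symb_x_surj n s : (r <= n)%N -> gr n.+1 s ->
  exists2 t, gr n t & s = symb 1 x * t.
Proof.
move=> rn /grP[a /(x_red rn)[b Fb ->] ->].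
by exists (symb n b); rewrite -?symbM ?add1n //; exact: symb_gr.
Qed.

Lemma symb_pow n : symb n (x ^+ n) = symb 1 x ^+ n /\ F n (x ^+ n).
Proof.
elim: n => [|n [e Fn]]; first by rewrite symb1 fil0.
rewrite !exprS -e -symbM ?add1n //; split=> //.
exact: (fil_mul (add1n n)).
Qed.

(** Degrees beyond r + 1 are reached by multiplication by x, and each of the
    finitely many remaining pieces is finitely generated. *)
Lemma rees_quot_generators : has_homogeneous_generators gr.
Proof.
have /choice[u uP] : forall n, exists s : seq A, F n = ideal_gen [set` s].
  by move=> n; apply: noethA; exact: fil_ideal.
pose L := [seq (n, a) | n <- iota 1 r.+1, a <- u n].
have LP i : (i < size L)%N ->
    (0 < (nth (0%N, 0%R) L i).1)%N /\ F (nth (0%N, 0%R) L i).1 (nth (0%N, 0%R) L i).2.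
  move=> iL; have /allpairsPdep[n [a [nr an ->]]] := mem_nth (0%N, 0%R) iL.
  split; first by move: nr; rewrite mem_iota => /andP[].
  by rewrite /= uP; exact: sub_ideal_gen.
pose f (i : 'I_(size L)) := symb (nth (0%N, 0%R) L i).1 (nth (0%N, 0%R) L i).2.
have f_deg (i : 'I_(size L)) : gr (nth (0%N, 0%R) L i).1 (f i).
  by apply: symb_gr; exact: (LP i (ltn_ord i)).2.
exists (size L), f, (fun i => (nth (0%N, 0%R) L i).1); split=> [i|].
  by split; [exact: (LP i (ltn_ord i)).1|exact: f_deg].
have idf := @ideal_gen_ideal S (range f).
apply/seteqP; split; apply: ideal_gen_sub => //; first exact: ideal_gen_ideal.
  move=> _ [i _ <-]; apply: sub_ideal_gen.
  by exists (nth (0%N, 0%R) L i).1; [exact: (LP i (ltn_ord i)).1|exact: f_deg].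
move=> s [n /= n0 ns]; elim: n n0 s ns => // n IH _ s ns.
have [rn|nr] := ltnP r n.
  have [t nt ->] := symb_x_surj (ltnW rn) ns.
  apply: (idealM idf); apply: IH => //; exact: leq_trans rn.
have /grP[a + ->] := ns; rewrite uP => ua.
suff H : [set a | F n.+1 a /\ ideal_gen (range f) (symb n.+1 a)] a by exact: H.2.
move: a ua; apply: ideal_gen_sub; first exact: (symb_preim_ideal _ idf).
move=> a ua; split; first by rewrite uP; exact: sub_ideal_gen.
have naL : (n.+1, a) \in L.
  by apply/allpairsPdep; exists n.+1, a; rewrite mem_iota.
have iL : (index (n.+1, a) L < size L)%N by rewrite index_mem.
apply: sub_ideal_gen; exists (Ordinal iL) => //.
by rewrite /f /= nth_index.
Qed.

Lemma symb_torsion n p a : F n a ->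
  symb 1 x ^+ p * symb n a = 0 <-> Q (p + n) (x ^+ p * a).
Proof.
move=> Fa; have [<- Fp] := symb_pow p; rewrite -symbM //.
by apply: symb_eq0; exact: (fil_mul erefl).
Qed.

Lemma rees_quot_reg_le B :
  (forall n p a, F n a -> ~ Q n a -> Q (p + n) (x ^+ p * a) ->
    (n%:Z%:E <= B)%E) ->
  (r%:Z%:E <= B)%E -> (reg gr <= B)%E.
Proof.
move=> torsB rB.
apply: (reg_le_torsion rees_grading (symb_gr Fx) symb_x_surj) rB.
move=> n _ p /grP[a Fa ->] /eqP a0 /(symb_torsion _ Fa) Qpa.
by apply: torsB Qpa => // /(symb_eq0 Fa).
Qed.

Lemma rees_quot_torsion_le_reg n p a : F n a -> ~ Q n a ->
  Q (p + n) (x ^+ p * a) -> (n%:Z%:E <= reg gr)%E.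
Proof.
move=> Fa Qa /(symb_torsion _ Fa).
apply: (torsion_le_reg rees_grading symb_x_surj rees_quot_generators
  (symb_gr Fa)).
by apply/eqP => /(symb_eq0 Fa).
Qed.

(** If x generated degree r of the quotient over degree r - 1, the same would
    hold in A by Nakayama, against the choice of r. For r = 0 the element is
    1. *)
Lemma rees_quot_generator_le_reg (m : idealr A) : local_ring m ->
  (forall n, Q n `<=` ideal_prod [set` m] (F n)) ->
  fil_int F r%:Z <> ideal_prod (ideal_gen [set x]) (fil_int F (r%:Z - 1)) ->
  (r%:Z%:E <= reg gr)%E.
Proof.
move=> locA Qm r_max.
suff [a Fa ax] : exists2 a, F r a & forall t, symb r a <> symb 1 x * t.
  exact: (generator_le_reg rees_grading (symb_gr Fx) symb_x_surj
    rees_quot_generators (symb_gr Fa) ax).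
apply: contrapT => no.
have {}no a : F r a -> exists t, symb r a = symb 1 x * t.
  move=> Fa; apply: contrapT => /forallNP na; apply: no; by exists a.
case: r r_max no => [|r'] r_max no.
  have [|t e] := no 1; first by rewrite fil0.
  have := cmpMl_lt rees_grading t (symb_gr Fx) (ltn0Sn 0).
  rewrite -e symb1 (cmp_id _ (gr1 rees_grading)) => /eqP.
  by rewrite oner_eq0.
apply: r_max; rewrite (_ : _ - 1 = r'%:Z) /=; last by lia.
by apply/esym/(principal_nakayama locA).
Qed.

End PrincipalReduction.
End ReesQuotients.

Section AssociatedGraded.
Variables (A : comNzRingType) (F : filtration A).

Lemma assoc_graded_surj (s : assoc_graded F) :
  exists p, \pi_(assoc_graded F)%qT p = s.
Proof. by exists (repr s); rewrite reprK. Qed.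

Definition next_fil (n : nat) : set A := F n.+1.

Lemma assoc_graded_ker (p : rees F) :
  \pi_(assoc_graded F)%qT p = 0 <-> forall n, next_fil n (val p)`_n.
Proof.
rewrite -(rmorph0 (\pi_(assoc_graded F)%qT)).
split=> [/eqP|Fp]; last apply/eqP; rewrite -Quotient.idealrBE subr0.
  by move/asboolP.
exact/asboolP.
Qed.

End AssociatedGraded.

(** * Residue field, fiber cone and principal reductions *)

Section ResidueField.
Variables (A : comNzRingType) (m : idealr A) (locA : local_ring m).

Definition residue_inv (y : {ideal_quot m}) : {ideal_quot m} :=
  if pselect (exists z, z * y = 1) is left ex then sval (cid ex) else 0.

Lemma pi_eq0 (a : A) : (\pi_({ideal_quot m})%qT a == 0) = (a \in m).
Proof. by rewrite -(rmorph0 (\pi_({ideal_quot m})%qT)) -Quotient.idealrBE subr0. Qed.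

Lemma residue_mulVf (y : {ideal_quot m}) : y != 0 -> residue_inv y * y = 1.
Proof.
move=> y0; rewrite /residue_inv; case: pselect => [ex|]; first exact: (svalP (cid ex)).
case; move: y0; rewrite -[y]reprK pi_eq0 => /(local_unit locA)[b b1].
by exists (\pi_({ideal_quot m})%qT b); rewrite -rmorphM b1 rmorph1.
Qed.

Lemma residue_inv0 : residue_inv 0 = 0.
Proof.
rewrite /residue_inv; case: pselect => // ex; exfalso; case: ex => z.
by rewrite mulr0 => /esym/eqP; rewrite oner_eq0.
Qed.

(** The quotient by m with a field structure, reached through a morphism so
    that the results on algebras over a field apply. *)
Lemma residue_field : exists (k : fieldType) (pk : {rmorphism A -> k}),
  [/\ forall c, exists a, pk a = c, forall a, (pk a == 0) = (a \in m)
    & infinite_set [set: {ideal_quot m}] -> infinite_set [set: k]].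
Proof.
pose k : fieldType := HB.pack {ideal_quot m}
  (GRing.ComNzRing_isField.Build {ideal_quot m} residue_mulVf residue_inv0).
pose pk : {rmorphism A -> k} := \pi_({ideal_quot m})%qT.
exists k, pk; split=> // [c|a]; last exact: pi_eq0.
by exists (repr (c : {ideal_quot m})); exact: reprK.
Qed.

End ResidueField.

Section FiberCone.
Variables (A : comNzRingType) (m : idealr A) (F : filtration A).

Definition maximal_fil n : set A := ideal_prod [set` m] (F n).
Local Notation mF := maximal_fil.

Lemma maximal_fil_sub n : mF n `<=` F n.
Proof.
apply: ideal_prod_sub; first exact: fil_ideal.
by move=> a b _; exact: filZ.
Qed.

Lemma maximal_fil_mul i j a b : F i a -> mF j b -> mF (i + j)%N (a * b).
Proof.
move=> Fa; move: b.
suff : mF j `<=` [set b | mF (i + j)%N (a * b)] by [].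
have idm := @ideal_prod_ideal A [set` m] (F (i + j)%N).
apply: ideal_prod_sub => [|c b mc Fb] /=.
  split=> [|u v|c u] /=; first by rewrite mulr0; exact: ideal0.
  - by rewrite mulrDr; exact: idealD.
  - by rewrite mulrCA; exact: idealM.
by rewrite mulrCA; apply: ideal_prodM => //; exact: (fil_mul erefl).
Qed.

(** An ideal generated in degree 0 is homogeneous, with m I_n in degree n. *)
Lemma fiber_idealP (p : rees F) :
  p \in fiber_ideal m F <-> forall n, mF n (val p)`_n.
Proof.
set X := [set q : rees F | exists2 a, a \in m & val q = a%:P].
have idX := @ideal_gen_ideal _ X.
have idm n := @ideal_prod_ideal A [set` m] (F n).
split=> [/asboolP|mp].
  suff : ideal_gen X `<=` [set p : rees F | forall n, mF n (val p)`_n].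
    by move=> H /H.
  apply: ideal_gen_sub => [|{}p [a am pa] n].
    split=> [n|u v mu mv n|u v mv n].
    - by rewrite raddf0 coef0; exact: (ideal0 (idm n)).
    - by rewrite raddfD coefD; exact: (idealD (idm n) (mu n) (mv n)).
    - rewrite rmorphM coefM; apply: (ideal_sum (idm n)) => i _.
      by rewrite -{1}(subnKC (leq_ord i)); apply: maximal_fil_mul => //; exact: reesP.
  rewrite pa coefC; case: eqP => [->|_]; last exact: (ideal0 (idm n)).
  by rewrite -[a]mulr1; apply: ideal_prodM => //; rewrite fil0.
apply/asboolP; rewrite -/X.
have -> : p = \sum_(i < size (val p)) rees_mono F i (val p)`_i.
  apply: val_inj; rewrite [LHS](poly_sumE (leqnn _)) raddf_sum.
  by apply: eq_bigr => i _ /=; rewrite val_rees_mono //; exact: reesP.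
apply: (ideal_sum idX) => i _.
suff : mF i `<=` [set a | F i a /\ ideal_gen X (rees_mono F i a)].
  by move=> /(_ _ (mp i)) /= [].
have monoD a b : F i a -> F i b ->
    rees_mono F i (a + b) = rees_mono F i a + rees_mono F i b.
  move=> Fa Fb; apply: val_inj; rewrite raddfD /= !val_rees_mono ?scalerDl //.
  exact: filD.
have monoM c a : F i a -> rees_mono F i (c * a) = rees_mono F 0 c * rees_mono F i a.
  move=> Fa; have F0 : F 0%N c by rewrite fil0.
  apply: val_inj; rewrite rmorphM /= !val_rees_mono //; last exact: filZ.
  by rewrite expr0 -scalerAl mul1r scalerA.
apply: ideal_prod_sub => [|a b am Fb].
  split=> [|a b [Fa Xa] [Fb Xb]|c a [Fa Xa]].
  - split; first exact: fil_zero.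
    rewrite (_ : rees_mono _ _ _ = 0); first exact: (ideal0 idX).
    by apply: val_inj; rewrite val_rees_mono ?scale0r ?raddf0 //; exact: fil_zero.
  - by split; [exact: filD|rewrite monoD //; exact: (idealD idX Xa Xb)].
  - by split; [exact: filZ|rewrite monoM //; exact: (idealM idX _ Xa)].
split; first exact: filZ.
rewrite monoM //; apply: (ideal_mulr idX); apply: sub_ideal_gen.
exists a => //; rewrite val_rees_mono ?fil0 //.
by rewrite expr0 alg_polyC.
Qed.

Lemma fiber_cone_surj (s : fiber_cone m F) :
  exists p, \pi_(fiber_cone m F)%qT p = s.
Proof. by exists (repr s); rewrite reprK. Qed.

Lemma fiber_cone_ker (p : rees F) :
  \pi_(fiber_cone m F)%qT p = 0 <-> forall n, mF n (val p)`_n.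
Proof.
rewrite -fiber_idealP -(rmorph0 (\pi_(fiber_cone m F)%qT)).
by split=> [/eqP|Fp]; [|apply/eqP]; rewrite -Quotient.idealrBE subr0.
Qed.

End FiberCone.

Section PrincipalReductions.
Variables (A : comNzRingType) (m : idealr A) (F : filtration A).
Hypotheses (noethA : noetherian A) (locA : local_ring m).
Hypothesis m_inf : infinite_set [set: {ideal_quot m}].
Hypothesis spread1 : (analytic_spread m F <= 1%:Z%:E)%E.

Local Notation S := (fiber_cone m F).
Local Notation q := (\pi_(fiber_cone m F)%qT : {rmorphism rees F -> fiber_cone m F}).
Local Notation sy := (symb q).
Local Notation gr := (rees_quot_comp q).

Let surj := @fiber_cone_surj A m F.
Let ker := @fiber_cone_ker A m F.

(** The fiber cone is an algebra over the residue field since m is killed in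
    degree 0. *)
Lemma residue_scalars (k : fieldType) (pk : {rmorphism A -> k}) :
  (forall c, exists a, pk a = c) -> (forall a, (pk a == 0) = (a \in m)) ->
  exists io : {rmorphism k -> S}, forall a, io (pk a) = sy 0 a.
Proof.
move=> pk_surj pk_ker; have /choice[l lP] := pk_surj.
have F0 a : F 0%N a by rewrite fil0.
have sy0_eq a b : pk a = pk b -> sy 0 a = sy 0 b.
  move=> ab.
  apply/(symb_eq ker) => //; rewrite -[a - b]mulr1.
  apply: (@ideal_prodM _ [set` m] (F 0%N)) => //.
  by rewrite /= -pk_ker rmorphB ab subrr.
pose io c := sy 0 (l c).
have ioE a : io (pk a) = sy 0 a by apply: sy0_eq; rewrite lP.
have io_add : zmod_morphism io.
  move=> c d; rewrite /io -symbB //; apply: sy0_eq.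
  by rewrite rmorphB !lP.
have io_mul : monoid_morphism io.
  split=> [|c d]; first by rewrite -(rmorph1 pk) ioE symb1.
  rewrite /io -symbM //; apply: sy0_eq.
  by rewrite rmorphM !lP.
pose ioM : {rmorphism k -> S} := HB.pack io
  (GRing.isZmodMorphism.Build _ _ io io_add)
  (GRing.isMonoidMorphism.Build _ _ io io_mul).
by exists ioM.
Qed.

Lemma fiber_dim_le1 (P : nat -> set S) : ~ prime_chain 2 P.
Proof.
move=> chain; have : (2%:Z%:E <= analytic_spread m F)%E.
  by apply: esup_ub; exists 2%N => //; exists P.
by move=> /le_trans/(_ spread1); rewrite lee_fin.
Qed.

(** In the fiber cone, the classes of generators of J generate an ideal
    containing all high degrees; a linear parameter among their combinations
    lifts to an element of J, and Nakayama transfers the divisibility back to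
    A. *)
Lemma reduction_principal J : is_reduction F J ->
  exists2 x, J x & is_reduction F (ideal_gen [set x]).
Proof.
move=> [idJ JF1 [N JN]].
have [k [pk [pk_surj pk_ker /(_ m_inf) k_inf]]] := residue_field locA.
have [io ioE] := residue_scalars pk_surj pk_ker.
have G := rees_grading surj ker.
have F0 a : F 0%N a by rewrite fil0.
have io_sy n a b : F n b -> sy n (a * b) = io (pk a) * sy n b.
  by move=> Fb; rewrite ioE -symbM.
have gr0_io s : gr 0 s -> exists c, s = io c.
  by move=> /grP[a _ ->]; exists (pk a); rewrite ioE.
have gr_fg n : exists ys : seq S, forall s, gr n s ->
    exists c : nat -> k, s = \sum_(i < size ys) io (c i) * ys`_i.
  have [u uP] := noethA (fil_ideal F n).
  exists (map (sy n) u) => s /grP[a + ->].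
  suff : F n `<=` [set a | F n a /\ exists c : nat -> k,
      sy n a = \sum_(i < size (map (sy n) u)) io (c i) * (map (sy n) u)`_i].
    by move=> H /H[].
  have Fu b : b \in u -> F n b by move=> bu; rewrite uP; exact: sub_ideal_gen.
  rewrite {1}uP; apply: ideal_gen_sub.
    split=> [|y z [Fy [c cy]] [Fz [d dz]]|e z [Fz [d dz]]].
    - split; first exact: fil_zero.
      exists (fun=> 0); rewrite (symb0 ker) big1 // => i _.
      by rewrite rmorph0 mul0r.
    - split; first exact: filD.
      exists (fun i => c i + d i); rewrite symbD // cy dz -big_split /=.
      by apply: eq_bigr => i _; rewrite rmorphD mulrDl.
    - split; first exact: filZ.
      exists (fun i => pk e * d i); rewrite io_sy // dz big_distrr /=.
      by apply: eq_bigr => i _; rewrite rmorphM mulrA.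
  move=> b /= bu; split; first exact: Fu.
  have iu : (index b u < size (map (sy n) u))%N by rewrite size_map index_mem.
  exists (fun i => (i == index b u)%:R); rewrite (bigD1 (Ordinal iu)) //= eqxx.
  rewrite rmorph1 mul1r (nth_map 0) ?index_mem // nth_index // big1 ?addr0 //.
  by move=> i /eqP/val_eqP /= /negPf ->; rewrite rmorph0 mul0r.
have [u uP] := noethA idJ.
have uJ b : b \in u -> J b by move=> bu; rewrite uP; exact: sub_ideal_gen.
have co : high_degrees gr (adjoins [set 0] (map (sy 1) u)).
  set I := adjoins _ _; have idI : is_ideal I by apply: adjoins_ideal; exact: zero_ideal.
  have JI : J `<=` [set a | F 1%N a /\ I (sy 1 a)].
    rewrite {1}uP; apply: ideal_gen_sub; first exact: (symb_preim_ideal ker).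
    move=> b /= bu; split; first exact/JF1/uJ.
    by apply: mem_adjoins; [exact: zero_ideal|exact: map_f].
  exists N.+1 => -[//|n] s nN /grP[a + ->]; rewrite -JN //.
  suff : ideal_prod J (F n) `<=` [set a | F n.+1 a /\ I (sy n.+1 a)].
    by move=> H /H[].
  apply: ideal_prod_sub; first exact: (symb_preim_ideal ker).
  move=> b c /JI[Fb Ib] Fc; split; first exact: (fil_mul (add1n n)).
  by rewrite -add1n symbM //; exact: ideal_mulr.
pose W := [set s | exists2 a, J a & s = sy 1 a].
have W0 : W 0 by exists 0; [exact: ideal0|rewrite (symb0 ker)].
have WD s t : W s -> W t -> W (s + t).
  move=> [a Ja ->] [b Jb ->]; exists (a + b); first exact: idealD.
  by rewrite symbD //; exact: JF1.
have WZ c s : W s -> W (io c * s).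
  have [a <-] := pk_surj c; move=> [b Jb ->].
  by exists (a * b); [exact: idealM|rewrite io_sy //; exact: JF1].
have W1 : W `<=` gr 1%N by move=> _ [a /JF1 Fa ->]; exact: symb_gr.
have uW : [set` map (sy 1) u] `<=` W.
  by move=> _ /= /mapP[b /uJ Jb ->]; exists b.
have [_ [x Jx ->] [M xM]] := linear_parameter G gr0_io k_inf gr_fg
  fiber_dim_le1 W0 WD WZ W1 uW co.
exists x => //; have Fx := JF1 _ Jx; split; first exact: ideal_gen_ideal.
  by apply: ideal_gen_sub; [exact: fil_ideal|move=> _ ->].
have mfilE i : maximal_fil m F i `<=` ideal_prod [set` m] (F i) by [].
exists M => n Mn; apply: (principal_nakayama surj ker noethA locA mfilE Fx).
move=> a Fa; have [|z /eqP] := xM n.+1 _ _ (symb_gr q Fa); first exact: leqW.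
by rewrite subr_eq0 => /eqP; exists z.
Qed.

End PrincipalReductions.

(** * Reduction numbers and the comparison of regularities *)

Section ReductionNumber.
Variables (A : comNzRingType) (F : filtration A).

Lemma principal_reduction_eq x n a :
  ideal_prod (ideal_gen [set x]) (F n) = F n.+1 -> F n.+1 a ->
  exists2 b, F n b & a = x * b.
Proof. by move=> <- /(ideal_prod1 _ _ (fil_ideal F n)). Qed.

(** Degree 0 always belongs to the supremum, because A differs from J; so the
    reduction number is a natural number. *)
Lemma reduction_numberP J : is_reduction F J -> exists r : nat,
  [/\ forall n, (r <= n)%N -> ideal_prod J (F n) = F n.+1,
      fil_int F r%:Z <> ideal_prod J (fil_int F (r%:Z - 1))
    & reduction_number_wrt F J = r%:Z%:E].
Proof.
move=> [idJ JF1 [N JN]].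
pose bad (n : nat) := fil_int F n%:Z <> ideal_prod J (fil_int F (n%:Z - 1)).
have bad0 : bad 0%N.
  rewrite /bad /= fil0 => JT; apply: (@fil1_1 _ F); apply: JF1.
  suff : [set: A] `<=` J by apply.
  rewrite {1}JT; apply: ideal_prod_sub => // x y Jx _.
  exact: ideal_mulr.
have badS n : bad n.+1 <-> F n.+1 <> ideal_prod J (F n).
  by rewrite /bad (_ : n.+1%:Z - 1 = n%:Z) //; lia.
have bad_le n : `[< bad n >] -> (n <= N)%N.
  case: n => // n /asboolP/badS Fn; rewrite ltnNge; apply/negP => Nn.
  by apply: Fn; rewrite JN.
have ex : exists n, `[< bad n >] by exists 0%N; exact/asboolP.
case: (ex_maxnP ex bad_le) => r /asboolP rbad rmax.
exists r; split=> // [n rn|].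
  apply: contrapT => ne; have /rmax : `[< bad n.+1 >].
    by apply/asboolP/badS => e; apply: ne.
  by rewrite ltnNge rn.
apply: esup_max => // -[n|n] nbad; last by [].
by rewrite lez_nat; apply: rmax; exact/asboolP.
Qed.

End ReductionNumber.

Lemma grade1_nonzerodivisor (A : comNzRingType) (I : set A) :
  grade I = 1%:Z%:E -> exists2 y, I y & forall z, y * z = 0 -> z = 0.
Proof.
move=> gI; apply: contrapT => no.
have : (grade I <= 0%:Z%:E)%E.
  apply: esup_le => _ [s [sI [_ reg_s]] <-]; rewrite lee_fin lez_nat leqNgt.
  apply/negP => s0; apply: no; exists s`_0; first by apply: sI; exact: mem_nth.
  have gen0 (z : A) : ideal_gen [set` take 0 s] z <-> z = 0.
    by rewrite take0 ideal_gen_seq.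
  by move=> z yz; apply: (gen0 z).1; apply: (reg_s 0%N s0); exact: (gen0 _).2.
by rewrite gI lee_fin.
Qed.

Lemma good_reduction (A : comNzRingType) (F : filtration A) :
  good F -> exists I, is_reduction F I.
Proof.
move=> [I [idI IF [N IN]]]; exists I; split=> //.
  move=> a Ia; apply: (IF 0%N); rewrite -[a]mulr1; apply: ideal_prodM => //.
  by rewrite fil0.
by exists N => n /IN.
Qed.

Section MainTheorem.
Variables (A : comNzRingType) (m : idealr A) (F : filtration A).
Hypotheses (noethA : noetherian A) (locA : local_ring m).
Hypothesis F_m : forall n, F n.+1 `<=` ideal_prod [set` m] (F n).

Let surjG := @assoc_graded_surj A F.
Let kerG := @assoc_graded_ker A F.
Let surjF := @fiber_cone_surj A m F.
Let kerF := @fiber_cone_ker A m F.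

Section Principal.
Variables (x : A) (r : nat).
Hypothesis Fx : F 1%N x.
Hypothesis x_red : forall n, (r <= n)%N ->
  ideal_prod (ideal_gen [set x]) (F n) = F n.+1.
Hypothesis r_max :
  fil_int F r%:Z <> ideal_prod (ideal_gen [set x]) (fil_int F (r%:Z - 1)).

Let x_surj n : (r <= n)%N -> forall a, F n.+1 a -> exists2 b, F n b & a = x * b.
Proof. by move=> /x_red xn a; exact: principal_reduction_eq. Qed.

Lemma x_surj_expn n p a : (r <= n)%N -> F (p + n)%N a ->
  exists2 b, F n b & a = x ^+ p * b.
Proof.
move=> rn; elim: p a => [|p IH] a; first by exists a; rewrite // expr0 mul1r.
rewrite addSn => /x_surj[|b /IH[c Fc ->] ->]; first exact: leq_trans (leq_addl _ _).
by exists c; rewrite // exprS mulrA.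
Qed.

Lemma reduction_number_le_reg_assoc :
  (r%:Z%:E <= reg (assoc_graded_comp F))%E.
Proof. exact: (rees_quot_generator_le_reg surjG kerG noethA Fx x_surj locA). Qed.

Lemma reduction_number_le_reg_fiber :
  (r%:Z%:E <= reg (fiber_cone_comp m F))%E.
Proof.
apply: (rees_quot_generator_le_reg surjF kerF noethA Fx x_surj locA) => //.
by move=> n.
Qed.

(** A torsion element a of the fiber cone above degree r is moved by an
    element b of m I_n to one that is killed by x^p in A itself. *)
Lemma reg_fiber_le_reg_assoc :
  (reg (fiber_cone_comp m F) <= reg (assoc_graded_comp F))%E.
Proof.
apply: (rees_quot_reg_le surjF kerF Fx x_surj); last first.
  exact: reduction_number_le_reg_assoc.
move=> n p a Fa a_m xa.
have [nr|rn] := leqP n r.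
  by apply: le_trans reduction_number_le_reg_assoc; rewrite lee_fin lez_nat.
have idm k := @ideal_prod_ideal A [set` m] (F k).
have [b mb xab] : exists2 b, maximal_fil m F n b & x ^+ p * a = x ^+ p * b.
  suff : maximal_fil m F (p + n)%N `<=`
      [set c | exists2 b, maximal_fil m F n b & c = x ^+ p * b].
    by move=> /(_ _ xa).
  apply: ideal_prod_sub => [|c d mc /(x_surj_expn (ltnW rn))[b Fb ->]].
    split=> [|u v [b mb ->] [c mc ->]|u v [b mb ->]].
    - by exists 0; [exact: (ideal0 (idm n))|rewrite mulr0].
    - by exists (b + c); [exact: (idealD (idm n) mb mc)|rewrite mulrDr].
    - by exists (u * b); [exact: (idealM (idm n) _ mb)|rewrite mulrCA].
  by exists (c * b); [exact: ideal_prodM|rewrite mulrCA].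
have Fab : F n (a - b) by apply: filB => //; exact: maximal_fil_sub mb.
apply: (rees_quot_torsion_le_reg surjG kerG noethA Fx x_surj (p := p) Fab).
  move=> /F_m mab; apply: a_m; rewrite -(subrK b a).
  exact: (idealD (idm n) mab mb).
by rewrite mulrBr xab subrr; exact: fil_zero.
Qed.

Hypothesis x_nzd : forall z, x * z = 0 -> z = 0.

(** If x^p a lies in I_(n+p+1) = x^p I_(n+1), then cancelling x^p puts a in
    I_(n+1). *)
Lemma reg_assoc_le_reduction_number :
  (reg (assoc_graded_comp F) <= r%:Z%:E)%E.
Proof.
apply: (rees_quot_reg_le surjG kerG Fx x_surj) => // n p a Fa a_n xa.
rewrite lee_fin lez_nat leqNgt; apply/negP => rn; apply: a_n.
move: xa; rewrite /next_fil -addnS => /x_surj_expn[|b Fb]; first exact/leqW/ltnW.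
move=> /eqP; rewrite -subr_eq0 -mulrBr => /eqP xab.
suff : a - b = 0 by move/eqP; rewrite subr_eq0 => /eqP ->.
elim: (p) xab => [|k IH]; first by rewrite expr0 mul1r.
by rewrite exprS -mulrA => /x_nzd.
Qed.

End Principal.

Hypothesis m_inf : infinite_set [set: {ideal_quot m}].
Hypothesis spread1 : (analytic_spread m F <= 1%:Z%:E)%E.

(** A power of y is a multiple of x. *)
Lemma reduction_nonzerodivisor x y :
  is_reduction F (ideal_gen [set x]) -> F 1%N y ->
  (forall z, y * z = 0 -> z = 0) -> forall z, x * z = 0 -> z = 0.
Proof.
move=> [_ _ [N xN]] Fy y_nzd z xz.
have Fyn n : F n (y ^+ n).
  elim: n => [|n IH]; first by rewrite fil0.
  by rewrite exprS; exact: (fil_mul (add1n n)).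
have [b _ yb] := principal_reduction_eq (xN N (leqnn N)) (Fyn N.+1).
have : y ^+ N.+1 * z = 0 by rewrite yb mulrAC xz mul0r.
elim: (N.+1) => [|k IH]; first by rewrite expr0 mul1r.
by rewrite exprS -mulrA => /y_nzd.
Qed.

(** A smaller reduction contains a principal one, with generator x a. If a
    were in m, Nakayama would make F n vanish for large n, though it contains
    x^n. *)
Lemma principal_reduction_minimal x : is_reduction F (ideal_gen [set x]) ->
  (forall z, x * z = 0 -> z = 0) -> is_minimal_reduction F (ideal_gen [set x]).
Proof.
move=> red_x x_nzd; split=> // K red_K Kx.
have [idK _ _] := red_K.
have [y Ky red_y] := reduction_principal noethA locA m_inf spread1 red_K.
apply/seteqP; split=> //.
have /ideal_gen1[a ya] := Kx _ Ky.
suff [b ba] : exists b, b * a = 1.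
  apply: ideal_gen_sub => // _ ->.
  by rewrite -[x]mulr1 -ba [b * a]mulrC mulrA -ya; exact: ideal_mulr.
apply: (local_unit locA); apply/negP => am.
have [_ xF1 [N xN]] := red_x; have [_ _ [M yM]] := red_y.
pose n := maxn N M.
have Fxn k : F k (x ^+ k).
  elim: k => [|k IH]; first by rewrite fil0.
  rewrite exprS; apply: (fil_mul (add1n k)) => //.
  by apply: xF1; exact: sub_ideal_gen.
have F0 : F n.+1 `<=` [set 0].
  have [s sF] := noethA (fil_ideal F n.+1).
  apply: (nakayama locA (@zero_ideal A) sF) => c.
  move=> /(principal_reduction_eq (yM n (leq_maxr _ _)))[b Fb ->].
  exists (y * b); last by rewrite /= subrr.
  rewrite ya [x * a]mulrC -mulrA; apply: ideal_prodM => //.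
  by rewrite -(xN n (leq_maxl _ _)); apply/ideal_prod1; [exact: fil_ideal|exists b].
have := F0 _ (Fxn n.+1); rewrite /= => xn0.
suff : 1 = 0 :> A by apply/eqP; rewrite oner_eq0.
move: xn0; rewrite -[x ^+ _]mulr1; elim: (n.+1) => [|k IH]; first by rewrite mul1r.
by rewrite exprS -mulrA => /x_nzd.
Qed.

Lemma minimal_reduction_principal J : is_minimal_reduction F J ->
  exists x, J = ideal_gen [set x].
Proof.
move=> [red_J minJ].
have [x Jx red_x] := reduction_principal noethA locA m_inf spread1 red_J.
exists x; apply/esym/minJ => //; apply: ideal_gen_sub; first by case: red_J.
by move=> _ ->.
Qed.

End MainTheorem.

Theorem theorem4p3 (A : comNzRingType) (m : idealr A) (d : nat)
    (F : filtration A) :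
  noetherian A -> local_ring m ->
  krull_dim A = d%:Z%:E -> (0 < d)%N ->
  infinite_set [set: {ideal_quot m}] ->
  good F ->
  (forall n, F n.+1 `<=` ideal_prod [set` m] (F n)) ->
  analytic_spread m F = 1%:Z%:E ->
  (reg (fiber_cone_comp m F) <= reg (assoc_graded_comp F))%E /\
  (grade (F 1%N) = 1%:Z%:E ->
     reg (fiber_cone_comp m F) = reg (assoc_graded_comp F) /\
     reg (assoc_graded_comp F) = reduction_number F).
Proof.
move=> noethA locA _ _ m_inf goodF F_m s1.
have spread1 : (analytic_spread m F <= 1%:Z%:E)%E by rewrite s1.
have principal := reduction_principal noethA locA m_inf spread1.
have mem1 x J : J = ideal_gen [set x] -> is_reduction F J -> F 1%N x.
  by move=> -> [_ + _]; apply; exact: sub_ideal_gen.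
have [I /principal[x _ red_x]] := good_reduction goodF.
have [r [x_red r_max _]] := reduction_numberP red_x.
have Fx := mem1 _ _ erefl red_x.
split; first exact: (reg_fiber_le_reg_assoc noethA locA F_m Fx x_red r_max).
move=> /grade1_nonzerodivisor[y Fy y_nzd].
have reg_eq z : is_reduction F (ideal_gen [set z]) ->
    reduction_number_wrt F (ideal_gen [set z]) = reg (assoc_graded_comp F).
  move=> red_z; have [k [z_red k_max ->]] := reduction_numberP red_z.
  have Fz := mem1 _ _ erefl red_z.
  apply/le_anti; rewrite (reduction_number_le_reg_assoc noethA locA F_m Fz z_red k_max).
  apply: (reg_assoc_le_reduction_number Fz z_red).
  exact: (reduction_nonzerodivisor red_z Fy y_nzd).
split.
  apply/le_anti; rewrite (reg_fiber_le_reg_assoc noethA locA F_m Fx x_red r_max) /=.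
  apply: (@le_trans _ _ r%:Z%:E).
    apply: (reg_assoc_le_reduction_number Fx x_red).
    exact: (reduction_nonzerodivisor red_x Fy y_nzd).
  exact: (reduction_number_le_reg_fiber noethA locA Fx x_red r_max).
rewrite /reduction_number.
suff -> : [set reduction_number_wrt F J | J in is_minimal_reduction F] =
    [set reg (assoc_graded_comp F)] by rewrite einf1.
apply/seteqP; split=> [_ [J minJ <-]|_ ->] /=.
  have [z Jz] := minimal_reduction_principal noethA locA m_inf spread1 minJ.
  by rewrite Jz; apply: reg_eq; rewrite -Jz; case: minJ.
exists (ideal_gen [set x]); last exact: reg_eq.
apply: (principal_reduction_minimal noethA locA m_inf spread1 red_x).
exact: (reduction_nonzerodivisor red_x Fy y_nzd).
Qed.
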